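(* Let $G$ be a finite group acting linearly on a finite-dimensional complex vector space $V$, and let $M$ be a quasianalytic DC-weight sequence. Let $c:(\mathbb{R},0)\to V/\!\!/G=\sigma(V)\subseteq\mathbb{C}^n$ be a germ of a $C^M$ curve. If $\bar c:(\mathbb{R},0)\to V$ is a $C^\infty$ germ with $\sigma\circ\bar c=c$, then $\bar c$ is a $C^M$ germ.
   Context: $\sigma=(\sigma_1,\dots,\sigma_n)$ for homogeneous generators $\sigma_1,\dots,\sigma_n$ of $\mathbb{C}[V]^G$; $V/\!\!/G$ is identified with $\sigma(V)\subseteq\mathbb{C}^n$. A DC-weight sequence is a non-decreasing sequence $M=(M_k)_{k\in\mathbb{N}}$ of positive reals with $M_0=1$, $M_k^2\le M_{k-1}M_{k+1}$ for $k\ge1$ and $\sup_{k\ge1}(M_{k+1}/M_k)^{1/k}<\infty$; it is quasianalytic if $\sum_{k\ge1}(k!M_k)^{-1/k}=\infty$. For $U\subseteq\mathbb{R}$ open, $C^M(U)$ consists of $f\in C^\infty(U)$ such that for every compact $K\subseteq U$ there are $C,\rho>0$ with $|f^{(k)}(x)|\le C\rho^k k!M_k$ for all $k$ and $x\in K$; complex- or vector-valued maps are $C^M$ if all real and imaginary parts of their components are. *)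

(* Defs.v *)
From mathcomp Require Import all_boot all_fingroup.
From Stdlib Require Import Reals Rtopology.

Definition Cplx : Type := (R * R)%type.
Definition C0 : Cplx := (0%R, 0%R).
Definition C1 : Cplx := (1%R, 0%R).
Definition Cadd (z w : Cplx) : Cplx := (fst z + fst w, snd z + snd w)%R.
Definition Cmul (z w : Cplx) : Cplx :=
  (fst z * fst w - snd z * snd w, fst z * snd w + snd z * fst w)%R.
Fixpoint Cpow (z : Cplx) (k : nat) : Cplx :=
  match k with O => C1 | S k' => Cmul z (Cpow z k') end.
Fixpoint Csum (m : nat) (f : nat -> Cplx) : Cplx :=
  match m with O => C0 | S m' => Cadd (Csum m' f) (f m') end.

Inductive cpoly : Type :=
| PC : Cplx -> cpoly
| PX : nat -> cpoly
| PAdd : cpoly -> cpoly -> cpoly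
| PMul : cpoly -> cpoly -> cpoly.

Fixpoint peval (x : nat -> Cplx) (p : cpoly) : Cplx :=
  match p with
  | PC c => c
  | PX i => x i
  | PAdd p q => Cadd (peval x p) (peval x q)
  | PMul p q => Cmul (peval x p) (peval x q)
  end.

Fixpoint pvars_lt (d : nat) (p : cpoly) : Prop :=
  match p with
  | PC _ => True
  | PX i => (i < d)%N
  | PAdd p q => pvars_lt d p /\ pvars_lt d q
  | PMul p q => pvars_lt d p /\ pvars_lt d q
  end.

Definition homogeneous (p : cpoly) : Prop :=
  exists k : nat, forall (t : Cplx) (x : nat -> Cplx),
    peval (fun i => Cmul t (x i)) p = Cmul (Cpow t k) (peval x p).

Definition act {gT : finGroupType} (d : nat) (rho : gT -> nat -> nat -> Cplx)
  (g : gT) (v : nat -> Cplx) : nat -> Cplx :=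
  fun i => Csum d (fun j => Cmul (rho g i j) (v j)).

Definition linear_action {gT : finGroupType} (d : nat)
  (rho : gT -> nat -> nat -> Cplx) : Prop :=
  (forall (v : nat -> Cplx) (i : nat), (i < d)%N -> act d rho 1%g v i = v i) /\
  (forall (g h : gT) (v : nat -> Cplx) (i : nat), (i < d)%N ->
     act d rho (g * h)%g v i = act d rho g (act d rho h v) i).

Definition invariant {gT : finGroupType} (d : nat)
  (rho : gT -> nat -> nat -> Cplx) (p : cpoly) : Prop :=
  pvars_lt d p /\ forall (g : gT) (x : nat -> Cplx), peval (act d rho g x) p = peval x p.

Definition hilbert_basis {gT : finGroupType} (d : nat)
  (rho : gT -> nat -> nat -> Cplx) (n : nat) (sigma : nat -> cpoly) : Prop :=
  (forall j, (j < n)%N -> invariant d rho (sigma j) /\ homogeneous (sigma j)) /\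
  (forall p, invariant d rho p ->
     exists q, pvars_lt n q /\
       forall x : nat -> Cplx, peval x p = peval (fun j => peval x (sigma j)) q).

Definition DC_weight (M : nat -> R) : Prop :=
  M 0%nat = 1%R /\
  (forall k, (0 < M k)%R) /\
  (forall k, (M k <= M (S k))%R) /\
  (forall k, (1 <= k)%N -> (M k ^ 2 <= M (k - 1)%nat * M (S k))%R) /\
  (exists B : R, forall k, (1 <= k)%N ->
     (Rpower (M (S k) / M k) (/ INR k) <= B)%R).

Definition quasianalytic (M : nat -> R) : Prop :=
  forall B : R, exists N : nat,
    (B < sum_f_R0 (fun i => Rpower (INR (Factorial.fact (S i)) * M (S i)) (- / INR (S i))) N)%R.

Definition derivs_on (U : R -> Prop) (f : R -> R) (D : nat -> R -> R) : Prop :=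
  (forall x, U x -> D 0%nat x = f x) /\
  (forall (k : nat) (x : R), U x -> derivable_pt_lim (D k) x (D (S k) x)).

Definition Cinf_on (U : R -> Prop) (f : R -> R) : Prop :=
  exists D, derivs_on U f D.

Definition CM_on (M : nat -> R) (U : R -> Prop) (f : R -> R) : Prop :=
  exists D, derivs_on U f D /\
    forall K : R -> Prop, included K U -> compact K ->
      exists Cc rho : R, (0 < Cc)%R /\ (0 < rho)%R /\
        forall (k : nat) (x : R), K x ->
          (Rabs (D k x) <= Cc * rho ^ k * INR (Factorial.fact k) * M k)%R.

Definition Cinf_vec (U : R -> Prop) (m : nat) (c : R -> nat -> Cplx) : Prop :=
  forall j, (j < m)%N ->
    Cinf_on U (fun t => fst (c t j)) /\ Cinf_on U (fun t => snd (c t j)).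

Definition CM_vec (M : nat -> R) (U : R -> Prop) (m : nat) (c : R -> nat -> Cplx) : Prop :=
  forall j, (j < m)%N ->
    CM_on M U (fun t => fst (c t j)) /\ CM_on M U (fun t => snd (c t j)).

Definition sym_interval (e : R) : R -> Prop := fun t => (- e < t < e)%R.

(* Main.v *)
Require Import Defs.
From Stdlib Require Import Reals Lra Lia Factorial Classical IndefiniteDescription.
From Coquelicot Require Import Coquelicot.
From Stdlib Require Import FunctionalExtensionality List Permutation.
Local Open Scope R_scope.

(* Every polynomial function f of the lift is a root of the monic polynomial P whose roots
   are its translates f_g, g in G; the coefficients of P are invariant, hence polynomials in
   c, hence of class C^M.  A smooth flat root w of a monic polynomial over C^M vanishes near
   0: by the Denjoy-Carleman theorem the flat coefficients vanish, so a power of w can be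
   split off until the constant coefficient has finite order at 0, which is impossible
   unless w = 0.  Applied to the orbit of f - f_g, this shows that f - f_g either vanishes or
   has finite order at 0.  If e of the f_g equal f, then Q = (d/dz)^(e-1) P satisfies
   Q(f) = 0 and dQ/dz (f) = t^k u with u(0) <> 0.  Writing f = T + t^k h with T a Taylor
   polynomial of f, Q(f) = 0 becomes an equation over C^M with simple root h, and h is C^M
   because it satisfies a polynomial differential equation over C^M. *)

(** * Weight sequences *)

Lemma INR_S_pos k : 0 < INR (S k).
Proof. apply lt_0_INR; lia. Qed.

Lemma INR_S_ge_1 k : 1 <= INR (S k).
Proof. apply (le_INR 1); lia. Qed.

Lemma INR_S_le_pow2 k : INR (S k) <= 2 ^ k.
Proof.
induction k as [|k IH]; [simpl; lra|].
pose proof (pow_R1_Rle 2 k ltac:(lra)); rewrite S_INR; simpl pow; lra.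
Qed.

Lemma INR_fact_S k : INR (fact (S k)) = INR (S k) * INR (fact k).
Proof. change (fact (S k)) with (S k * fact k)%nat; apply mult_INR. Qed.

Definition log_convex (M : nat -> R) : Prop :=
  (forall k, 0 < M k) /\ (forall k, M (S k) ^ 2 <= M k * M (S (S k))).

Lemma log_convex_ratio_incr M : log_convex M ->
  forall k j, M (S k) * M (k + j)%nat <= M k * M (S (k + j)).
Proof.
intros [pos conv] k j; induction j as [|j IH].
{ rewrite Nat.add_0_r; lra. }
rewrite Nat.add_succ_r; set (i := (k + j)%nat) in *.
pose proof (conv i).
pose proof (pos k); pose proof (pos (S k)).
pose proof (pos i); pose proof (pos (S i)); pose proof (pos (S (S i))).
apply Rmult_le_reg_r with (M i); [easy|].
apply Rle_trans with (M k * M (S i) * M (S i)); nra.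
Qed.

Lemma log_convex_mult_le M : log_convex M -> forall j k, M j * M k <= M 0%nat * M (j + k)%nat.
Proof.
intros HM j k; pose proof (proj1 HM) as pos; induction j as [|j IH]; [simpl; lra|].
pose proof (log_convex_ratio_incr M HM j k) as ratio.
change (S j + k)%nat with (S (j + k)).
pose proof (pos 0%nat); pose proof (pos j); pose proof (pos k); pose proof (pos (S j)).
apply Rmult_le_reg_l with (M j); [easy|].
apply Rle_trans with (M (S j) * (M 0%nat * M (j + k)%nat)); [nra|].
apply Rmult_le_compat_l with (r := M 0%nat) in ratio; lra.
Qed.

Lemma DC_weight_log_convex M : DC_weight M -> log_convex M.
Proof.
intros (_ & pos & _ & conv & _); split; [exact pos|intros k].
specialize (conv (S k) eq_refl).
replace (ssrnat.subn (S k) 1) with k in conv; [exact conv|].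
unfold ssrnat.subn; destruct k; reflexivity.
Qed.

Lemma DC_weight_pos M k : DC_weight M -> 0 < M k.
Proof. intros (_ & pos & _); apply pos. Qed.

Lemma DC_weight_succ_le M : DC_weight M ->
  exists B, 1 <= B /\ forall k, M (S k) <= B ^ S k * M k.
Proof.
intros (M0 & pos & _ & _ & B & ratio).
set (B' := Rmax 1 (Rmax B (M 1%nat))).
assert (B'_ge_1 : 1 <= B') by apply Rmax_l.
assert (B_le : B <= B') by (eapply Rle_trans; [apply Rmax_l|apply Rmax_r]).
assert (M1_le : M 1%nat <= B') by (eapply Rle_trans; [apply Rmax_r|apply Rmax_r]).
exists B'; split; [easy|]; intros [|k]; [rewrite M0; simpl; lra|].
specialize (ratio (S k) eq_refl).
pose proof (pos (S k)); pose proof (pos (S (S k))); pose proof (INR_S_pos k).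
set (q := M (S (S k)) / M (S k)) in *.
assert (q_pos : 0 < q) by now apply Rdiv_lt_0_compat.
assert (q_root : Rpower q (/ INR (S k)) ^ S k = q).
{ rewrite <- Rpower_pow by apply exp_pos.
  rewrite Rpower_mult, Rinv_l, Rpower_1 by lra; reflexivity. }
replace (M (S (S k))) with (q * M (S k)) by (unfold q; field; lra).
apply Rmult_le_compat_r; [lra|].
apply Rle_trans with (B' ^ S k); [|apply Rle_pow; [easy|lia]].
rewrite <- q_root; apply pow_incr; split; [left; apply exp_pos|lra].
Qed.

Definition inv_square (k : nat) : R := / INR (S k) ^ 2.

Lemma inv_square_pos k : 0 < inv_square k.
Proof. apply Rinv_0_lt_compat, pow_lt, INR_S_pos. Qed.

Lemma inv_square_succ_le k : inv_square (S k) <= inv_square k.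
Proof.
pose proof (INR_S_pos k); pose proof (S_INR (S k)).
apply Rinv_le_contravar; [apply pow_lt|apply pow_incr]; lra.
Qed.

Lemma inv_square_le_succ k : inv_square k <= 4 * inv_square (S k).
Proof.
unfold inv_square; rewrite (S_INR (S k)); pose proof (INR_S_ge_1 k).
set (x := INR (S k)) in *.
apply Rmult_le_reg_r with (x ^ 2 * (x + 1) ^ 2); [nra|].
replace (/ x ^ 2 * (x ^ 2 * (x + 1) ^ 2)) with ((x + 1) ^ 2) by (field; lra).
replace (4 * / (x + 1) ^ 2 * (x ^ 2 * (x + 1) ^ 2)) with (4 * x ^ 2) by (field; lra).
nra.
Qed.

Lemma inv_square_sum_le n : sum_f_R0 inv_square n <= 2 - / INR (S n).
Proof.
induction n as [|n IH]; [unfold inv_square; simpl; lra|].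
rewrite tech5; enough (inv_square (S n) <= / INR (S n) - / INR (S (S n))) by lra.
unfold inv_square; rewrite (S_INR (S n)); pose proof (INR_S_pos n).
set (x := INR (S n)) in *.
apply Rmult_le_reg_r with (x * (x + 1) ^ 2); [nra|].
replace (/ (x + 1) ^ 2 * (x * (x + 1) ^ 2)) with x by (field; nra).
replace ((/ x - / (x + 1)) * (x * (x + 1) ^ 2)) with (x + 1) by (field; nra).
lra.
Qed.

(* With a = j+1 and b = k-j+1 one has 1/(a b) = (1/a + 1/b)/(k+2). *)
Lemma inv_square_mult_le j k : (j <= k)%nat ->
  inv_square j * inv_square (k - j) <=
  (inv_square j + inv_square (k - j)) * (2 * inv_square k).
Proof.
intros j_le; unfold inv_square.
pose proof (INR_S_ge_1 j); pose proof (INR_S_ge_1 (k - j)); pose proof (INR_S_pos k).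
assert (sum : INR (S j) + INR (S (k - j)) = INR (S k) + 1)
  by (rewrite !S_INR, minus_INR by easy; ring).
set (a := INR (S j)) in *; set (b := INR (S (k - j))) in *; set (c := INR (S k)) in *.
apply Rmult_le_reg_r with (a ^ 2 * b ^ 2 * c ^ 2).
{ repeat apply Rmult_lt_0_compat; lra. }
replace (/ a ^ 2 * / b ^ 2 * (a ^ 2 * b ^ 2 * c ^ 2)) with (c ^ 2) by (field; lra).
replace ((/ a ^ 2 + / b ^ 2) * (2 * / c ^ 2) * (a ^ 2 * b ^ 2 * c ^ 2)) with
  (2 * (a ^ 2 + b ^ 2)) by (field; lra).
replace c with (a + b - 1) by lra.
pose proof (pow2_ge_0 (a - b)); nra.
Qed.

Lemma inv_square_conv_le k :
  sum_f_R0 (fun j => inv_square j * inv_square (k - j)) k <= 8 * inv_square k.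
Proof.
eapply Rle_trans; [apply sum_Rle; intros j j_le; now apply inv_square_mult_le|].
rewrite <- scal_sum, sum_plus, (sum_f_R0_skip inv_square).
pose proof (inv_square_sum_le k); pose proof (inv_square_pos k).
pose proof (Rinv_0_lt_compat _ (INR_S_pos k)); nra.
Qed.

(* The factor 1/(k+1)^2 makes the sequence submultiplicative for convolution, so that
   the functions whose jets it dominates form an algebra. *)
Definition damped (M : nat -> R) (k : nat) : R := M k * inv_square k.

Lemma damped_pos M k : DC_weight M -> 0 < damped M k.
Proof. intros HM; apply Rmult_lt_0_compat; [now apply DC_weight_pos|apply inv_square_pos]. Qed.

Lemma damped_0 M : DC_weight M -> damped M 0 = 1.
Proof. intros [M0 _]; unfold damped, inv_square; rewrite M0; simpl; field. Qed.

Lemma damped_le M k : DC_weight M -> damped M k <= M k.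
Proof.
intros HM; pose proof (DC_weight_pos M k HM); pose proof (INR_S_ge_1 k).
unfold damped, inv_square; rewrite <- (Rmult_1_r (M k)) at 2.
apply Rmult_le_compat_l; [lra|].
rewrite <- Rinv_1; apply Rinv_le_contravar; nra.
Qed.

Lemma le_damped M k : DC_weight M -> M k <= 4 ^ k * damped M k.
Proof.
intros HM; pose proof (DC_weight_pos M k HM); pose proof (INR_S_pos k).
unfold damped, inv_square.
replace (4 ^ k) with ((2 ^ k) ^ 2)
  by (rewrite <- pow_mult, Nat.mul_comm, pow_mult; f_equal; ring).
rewrite <- (Rmult_1_r (M k)) at 1.
replace ((2 ^ k) ^ 2 * (M k * / INR (S k) ^ 2)) with (M k * (2 ^ k / INR (S k)) ^ 2)
  by (field; lra).
apply Rmult_le_compat_l; [lra|]; rewrite <- (pow1 2); apply pow_incr; split; [lra|].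
apply Rmult_le_reg_r with (INR (S k)); [easy|].
pose proof (INR_S_le_pow2 k); unfold Rdiv; rewrite Rmult_assoc, Rinv_l; lra.
Qed.

Lemma damped_le_succ M k : DC_weight M -> damped M k <= 4 * damped M (S k).
Proof.
intros HM; pose proof HM as (_ & pos & incr & _).
pose proof (pos k); pose proof (incr k); pose proof (inv_square_pos (S k)).
pose proof (inv_square_le_succ k); unfold damped.
apply Rle_trans with (M k * (4 * inv_square (S k))); nra.
Qed.

Lemma damped_succ_le M : DC_weight M ->
  exists B, 1 <= B /\ forall k, INR (S k) * damped M (S k) <= B ^ S k * damped M k.
Proof.
intros HM; destruct (DC_weight_succ_le M HM) as (B & B_ge_1 & ratio).
exists (2 * B); split; [lra|intros k]; specialize (ratio k).
pose proof (DC_weight_pos M k HM); pose proof (DC_weight_pos M (S k) HM).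
pose proof (inv_square_pos (S k)); pose proof (inv_square_succ_le k).
assert (step : damped M (S k) <= B ^ S k * M k * inv_square k)
  by (apply Rmult_le_compat; lra).
rewrite Rpow_mult_distr.
replace (2 ^ S k * B ^ S k * damped M k) with (2 ^ S k * (B ^ S k * M k * inv_square k))
  by (unfold damped; ring).
pose proof (INR_S_le_pow2 k); pose proof (pow_lt 2 k ltac:(lra)).
pose proof (INR_S_pos k); pose proof (damped_pos M (S k) HM).
apply Rmult_le_compat; [lra|lra|simpl pow; lra|exact step].
Qed.

Lemma damped_conv_le M k : DC_weight M ->
  sum_f_R0 (fun j => damped M j * damped M (k - j)) k <= 8 * damped M k.
Proof.
intros HM; pose proof (DC_weight_pos M k HM).
apply Rle_trans with (sum_f_R0 (fun j => inv_square j * inv_square (k - j) * M k) k).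
- apply sum_Rle; intros j j_le; unfold damped.
  pose proof (log_convex_mult_le M (DC_weight_log_convex M HM) j (k - j)) as mult_le.
  replace (j + (k - j))%nat with k in mult_le by lia; rewrite (proj1 HM), Rmult_1_l in mult_le.
  pose proof (inv_square_pos j); pose proof (inv_square_pos (k - j)).
  replace (M j * inv_square j * (M (k - j)%nat * inv_square (k - j))) with
    (inv_square j * inv_square (k - j) * (M j * M (k - j)%nat)) by ring.
  apply Rmult_le_compat_l; [|easy]; apply Rmult_le_pos; lra.
- rewrite <- scal_sum; unfold damped.
  pose proof (inv_square_conv_le k); nra.
Qed.

(** * Complex-valued functions of a real variable *)

Lemma locally_Rabs_lt (x r : R) : Rabs x < r -> locally x (fun y => Rabs y < r).
Proof.
intros x_lt; exists (mkposreal (r - Rabs x) ltac:(lra)); intros y y_near.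
change (Rabs (y - x) < r - Rabs x) in y_near.
pose proof (Rabs_triang_inv y x); lra.
Qed.

Lemma is_derive_ext_ball {V : NormedModule R_AbsRing} r (f g : R -> V) x l :
  (forall y, Rabs y < r -> f y = g y) -> Rabs x < r -> is_derive f x l -> is_derive g x l.
Proof.
intros fg x_lt; apply is_derive_ext_loc.
generalize (locally_Rabs_lt x r x_lt); now apply filter_imp.
Qed.

Lemma RtoC_neq_0 x : x <> 0 -> RtoC x <> 0%C.
Proof. intros x_neq E; now apply RtoC_inj in E. Qed.

Lemma Cmult_eq_reg_l (z u v : C) : z <> 0%C -> (z * u = z * v)%C -> u = v.
Proof.
intros z_neq zu_eq; replace u with (/ z * (z * u))%C by (field; easy).
rewrite zu_eq; field; easy.
Qed.

Lemma Rabs_fst_le_Cmod (z : C) : Rabs (fst z) <= Cmod z.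
Proof. eapply Rle_trans; [apply Rmax_l|apply Rmax_Cmod]. Qed.

Lemma Rabs_snd_le_Cmod (z : C) : Rabs (snd z) <= Cmod z.
Proof. eapply Rle_trans; [apply Rmax_r|apply Rmax_Cmod]. Qed.

Lemma Cmod_le_add_Rabs (z : C) : Cmod z <= Rabs (fst z) + Rabs (snd z).
Proof.
replace z with (RtoC (fst z) + Ci * RtoC (snd z))%C at 1
  by (apply injective_projections; simpl; ring).
eapply Rle_trans; [apply Cmod_triangle|].
rewrite Cmod_mult, Cmod_Ci, !Cmod_R; lra.
Qed.

Lemma C_re_im_scal (z : C) :
  plus (scal (fst z) (RtoC 1)) (scal (snd z) Ci : C_R_NormedModule) = z.
Proof.
rewrite !scal_R_Cmult; change (RtoC (fst z) * RtoC 1 + RtoC (snd z) * Ci = z)%C.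
apply injective_projections; simpl; ring.
Qed.

Lemma is_derive_C_iff (f : R -> C) x (l : C) : is_derive f x l <->
  is_derive (fun t => fst (f t)) x (fst l) /\ is_derive (fun t => snd (f t)) x (snd l).
Proof.
split.
- intros df; split.
  + apply (filterdiff_comp' f fst x (fun y => scal y l) fst df).
    apply filterdiff_linear, is_linear_fst.
  + apply (filterdiff_comp' f snd x (fun y => scal y l) snd df).
    apply filterdiff_linear, is_linear_snd.
- intros [df1 df2].
  apply (is_derive_scal_l (V := C_R_NormedModule) _ _ _ (RtoC 1)) in df1.
  apply (is_derive_scal_l (V := C_R_NormedModule) _ _ _ Ci) in df2.
  pose proof (is_derive_plus _ _ _ _ _ df1 df2) as df.
  rewrite C_re_im_scal in df; revert df; apply is_derive_ext; intros t; apply C_re_im_scal.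
Qed.

Lemma is_derive_C_unique (f : R -> C) x (l m : C) : is_derive f x l -> is_derive f x m -> l = m.
Proof.
rewrite !is_derive_C_iff; intros [l1 l2] [m1 m2].
apply is_derive_unique in l1, l2, m1, m2.
apply injective_projections; congruence.
Qed.

Lemma is_derive_Cmult (f g : R -> C) x (l m : C) : is_derive f x l -> is_derive g x m ->
  is_derive (fun t => f t * g t)%C x (l * g x + f x * m)%C.
Proof.
rewrite !is_derive_C_iff; intros [l1 l2] [m1 m2]; split.
- replace (fst (l * g x + f x * m)%C) with
    ((fst l * fst (g x) + fst (f x) * fst m) - (snd l * snd (g x) + snd (f x) * snd m))
    by (simpl; ring).
  exact (is_derive_minus _ _ _ _ _ (Derive.is_derive_mult _ _ _ _ _ l1 m1)
           (Derive.is_derive_mult _ _ _ _ _ l2 m2)).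
- replace (snd (l * g x + f x * m)%C) with
    ((fst l * snd (g x) + fst (f x) * snd m) + (snd l * fst (g x) + snd (f x) * fst m))
    by (simpl; ring).
  exact (is_derive_plus _ _ _ _ _ (Derive.is_derive_mult _ _ _ _ _ l1 m2)
           (Derive.is_derive_mult _ _ _ _ _ l2 m1)).
Qed.

Lemma is_derive_Cscal (a : C) (f : R -> C) x (l : C) :
  is_derive f x l -> is_derive (fun t => a * f t)%C x (a * l)%C.
Proof.
intros df; pose proof (is_derive_Cmult (fun _ => a) f x 0%C l (is_derive_const _ _) df) as dp.
replace (a * l)%C with (0 * f x + a * l)%C by ring; exact dp.
Qed.

Lemma Cneq_0_norm_pos (z : C) : z <> 0%C -> 0 < fst z * fst z + snd z * snd z.
Proof.
intros z_neq; apply Cmod_gt_0 in z_neq.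
pose proof (Rle_0_sqr (fst z)) as fst_sqr; pose proof (Rle_0_sqr (snd z)) as snd_sqr.
unfold Rsqr in *; apply Rnot_le_lt; intros norm_le.
pose proof (Cmod_le_add_Rabs z) as bound.
replace (fst z) with 0 in bound by nra; replace (snd z) with 0 in bound by nra.
rewrite Rabs_R0 in bound; lra.
Qed.

Lemma is_derive_Cinv (f : R -> C) x (l : C) : f x <> 0%C -> is_derive f x l ->
  is_derive (fun t => / f t)%C x (- (/ f x * / f x) * l)%C.
Proof.
intros f_neq; apply Cneq_0_norm_pos in f_neq; rewrite !is_derive_C_iff; intros [l1 l2].
assert (norm_derive : is_derive (fun t => fst (f t) ^ 2 + snd (f t) ^ 2) x
  (2 * (fst l * fst (f x) + snd l * snd (f x)))).
{ replace (2 * (fst l * fst (f x) + snd l * snd (f x))) with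
    (INR 2 * fst l * fst (f x) ^ 1 + INR 2 * snd l * snd (f x) ^ 1) by (simpl; ring).
  exact (is_derive_plus _ _ _ _ _ (is_derive_pow _ 2 _ _ l1) (is_derive_pow _ 2 _ _ l2)). }
assert (norm_neq : fst (f x) ^ 2 + snd (f x) ^ 2 <> 0) by lra.
split.
- replace (fst (- (/ f x * / f x) * l)%C) with
    ((fst l * (fst (f x) ^ 2 + snd (f x) ^ 2)
      - fst (f x) * (2 * (fst l * fst (f x) + snd l * snd (f x))))
     / (fst (f x) ^ 2 + snd (f x) ^ 2) ^ 2) by (simpl; field; lra).
  exact (is_derive_div _ _ _ _ _ l1 norm_derive norm_neq).
- replace (snd (- (/ f x * / f x) * l)%C) with
    ((- snd l * (fst (f x) ^ 2 + snd (f x) ^ 2)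
      - - snd (f x) * (2 * (fst l * fst (f x) + snd l * snd (f x))))
     / (fst (f x) ^ 2 + snd (f x) ^ 2) ^ 2) by (simpl; field; lra).
  exact (is_derive_div _ _ _ _ _ (is_derive_opp _ _ _ l2) norm_derive norm_neq).
Qed.

(* The real mean value theorem is applied to the real part of the product of [f] with the
   conjugate of [f y - f x]. *)
Lemma Cmod_variation_le (f df : R -> C) D x y :
  (forall t, Rabs (t - x) <= Rabs (y - x) -> is_derive f t (df t) /\ Cmod (df t) <= D) ->
  Cmod (f y - f x) <= D * Rabs (y - x).
Proof.
intros Hf; set (v := (f y - f x)%C).
destruct (Req_dec (Cmod v) 0) as [->|v_neq].
{ apply Rmult_le_pos; [|apply Rabs_pos].
  eapply Rle_trans; [apply Cmod_ge_0|apply (Hf x)].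
  rewrite Rminus_diag, Rabs_R0; apply Rabs_pos. }
pose proof (Cmod_ge_0 v).
apply Rmult_le_reg_l with (Cmod v); [lra|].
pose proof (bounded_variation (fun t => fst (Cconj v * f t)%C) (fun t => fst (Cconj v * df t)%C)
  (Cmod v * D) x y) as variation.
rewrite Rmult_assoc in variation.
eapply Rle_trans; [|apply variation].
- replace (fst (Cconj v * f y)%C - fst (Cconj v * f x)%C) with (Cmod v * Cmod v);
    [apply Rle_abs|].
  apply RtoC_inj; replace (Cmod v * Cmod v) with (Cmod v ^ 2) by ring.
  rewrite Cmod2_conj; apply injective_projections; simpl; ring.
- intros t t_near; destruct (Hf t t_near) as [dft dft_le]; split.
  + apply is_derive_C_iff, (is_derive_Cscal (Cconj v)), dft.
  + eapply Rle_trans; [apply Rabs_fst_le_Cmod|].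
    rewrite Cmod_mult, Cmod_conj; apply Rmult_le_compat_l; easy.
Qed.

Lemma Cmod_sum_n_le (u : nat -> C) n : Cmod (sum_n u n) <= sum_f_R0 (fun j => Cmod (u j)) n.
Proof.
induction n as [|n IH]; [rewrite sum_O; simpl; lra|].
rewrite sum_Sn, tech5; eapply Rle_trans; [apply Cmod_triangle|]; lra.
Qed.

Lemma sum_n_Cplus (u v : nat -> C) n :
  sum_n (fun j => u j + v j)%C n = (sum_n u n + sum_n v n)%C.
Proof. exact (sum_n_plus u v n). Qed.

Lemma sum_n_Cmult_l a (u : nat -> C) n : sum_n (fun j => a * u j)%C n = (a * sum_n u n)%C.
Proof. exact (sum_n_mult_l (K := C_Ring) a u n). Qed.

Lemma sum_n_first (u : nat -> C) n :
  sum_n u (S n) = (u 0%nat + sum_n (fun j => u (S j)) n)%C.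
Proof. unfold sum_n; rewrite sum_Sn_m, sum_n_m_S by lia; reflexivity. Qed.

(** * Jets *)

(* [d k] stands for f^(k)/k!, so that products of functions correspond to Cauchy products
   of jets. *)
Definition jet (r : R) (f : R -> C) (d : nat -> R -> C) : Prop :=
  (forall x, Rabs x < r -> d 0%nat x = f x) /\
  (forall k x, Rabs x < r -> is_derive (d k) x (INR (S k) * d (S k) x)%C).

Lemma jet_restrict r r' f d : r' <= r -> jet r f d -> jet r' f d.
Proof. intros r_le [d0 dS]; split; intros; [apply d0|apply dS]; lra. Qed.

Lemma jet_ext r f g d : (forall x, Rabs x < r -> f x = g x) -> jet r f d -> jet r g d.
Proof. intros fg [d0 dS]; split; [intros x x_lt; rewrite d0, fg|]; easy. Qed.

Lemma jet_is_derive r f d x : jet r f d -> Rabs x < r -> is_derive f x (d 1%nat x).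
Proof.
intros [d0 dS] x_lt; apply (is_derive_ext_ball r (d 0%nat)); [easy|easy|].
replace (d 1%nat x) with (INR 1 * d 1%nat x)%C by (simpl; ring); now apply dS.
Qed.

Lemma jet_tail r f d : jet r f d -> jet r (d 1%nat) (fun k x => INR (S k) * d (S k) x)%C.
Proof.
intros [_ dS]; split; [intros x _; simpl; ring|].
intros k x x_lt; now apply is_derive_Cscal, dS.
Qed.

Lemma RtoC_INR_S_neq_0 k : RtoC (INR (S k)) <> 0%C.
Proof. apply RtoC_neq_0, not_0_INR; easy. Qed.

Lemma jet_primitive r (f phi : R -> C) d :
  (forall x, Rabs x < r -> is_derive f x (phi x)) -> jet r phi d ->
  jet r f (fun k x => match k with O => f x | S j => / INR (S j) * d j x end)%C.
Proof.
intros df [d0 dS]; split; [easy|]; intros [|k] x x_lt.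
- replace (INR 1 * (/ INR 1 * d 0%nat x))%C with (phi x); [auto|].
  rewrite d0 by easy; field; apply RtoC_INR_S_neq_0.
- replace (INR (S (S k)) * (/ INR (S (S k)) * d (S k) x))%C with
    (/ INR (S k) * (INR (S k) * d (S k) x))%C
    by (field; split; apply RtoC_INR_S_neq_0).
  now apply is_derive_Cscal, dS.
Qed.

Lemma jet_unique r f d e : jet r f d -> jet r f e -> forall k x, Rabs x < r -> d k x = e k x.
Proof.
intros [d0 dS] [e0 eS] k; induction k as [|k IH]; intros x x_lt; [now rewrite d0, e0|].
pose proof (is_derive_ext_ball r _ (e k) x _ IH x_lt (dS k x x_lt)) as de.
apply (is_derive_C_unique _ _ _ _ (eS k x x_lt)) in de.
replace (d (S k) x) with (/ INR (S k) * (INR (S k) * d (S k) x))%C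
  by (field; apply RtoC_INR_S_neq_0).
rewrite <- de; field; apply RtoC_INR_S_neq_0.
Qed.

Lemma jet_plus r f g d e : jet r f d -> jet r g e ->
  jet r (fun x => f x + g x)%C (fun k x => d k x + e k x)%C.
Proof.
intros [d0 dS] [e0 eS]; split; [intros x x_lt; now rewrite d0, e0|].
intros k x x_lt; rewrite Cmult_plus_distr_l.
apply (is_derive_plus (d k) (e k) x (INR (S k) * d (S k) x)%C (INR (S k) * e (S k) x)%C); auto.
Qed.

Definition cauchy_product (d e : nat -> R -> C) (k : nat) (x : R) : C :=
  sum_n (fun j => d j x * e (k - j)%nat x)%C k.

Lemma Cmult_permute (u v w : C) : (u * (v * w) = v * (u * w))%C.
Proof. ring. Qed.

Lemma cauchy_product_leibniz (a b : nat -> C) k :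
  sum_n (fun j => INR (S j) * a (S j) * b (k - j)%nat +
                  a j * (INR (S (k - j)) * b (S (k - j))))%C k
  = (INR (S k) * sum_n (fun j => a j * b (S k - j)%nat)%C (S k))%C.
Proof.
pose (term j := (a j * b (S k - j)%nat)%C).
assert (left_sum : sum_n (fun j => INR (S j) * a (S j) * b (k - j)%nat)%C k =
                   sum_n (fun j => INR j * term j)%C (S k)).
{ rewrite sum_n_first; unfold term; cbn [INR Nat.sub].
  rewrite Cmult_0_l, Cplus_0_l; apply sum_n_ext; intros j.
  symmetry; apply (Cmult_assoc (INR (S j))). }
assert (right_sum : sum_n (fun j => a j * (INR (S (k - j)) * b (S (k - j))))%C k =
                    sum_n (fun j => INR (S k - j) * term j)%C (S k)).
{ rewrite (sum_Sn _ k), Nat.sub_diag; unfold term; cbn [INR].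
  change plus with Cplus; rewrite Cmult_0_l, Cplus_0_r.
  apply sum_n_ext_loc; intros j j_le.
  replace (S k - j)%nat with (S (k - j)) by lia.
  apply (Cmult_permute (a j)). }
rewrite sum_n_Cplus, left_sum, right_sum, <- sum_n_Cplus, <- sum_n_Cmult_l.
apply sum_n_ext_loc; intros j j_le; rewrite minus_INR, RtoC_minus by easy.
apply (eq_sym (x := INR (S k) * term j)%C); ring.
Qed.

Lemma jet_mult r f g d e : jet r f d -> jet r g e ->
  jet r (fun x => f x * g x)%C (cauchy_product d e).
Proof.
intros [d0 dS] [e0 eS]; split; unfold cauchy_product.
- intros x x_lt; rewrite sum_O; simpl; now rewrite d0, e0.
- intros k x x_lt; rewrite <- (cauchy_product_leibniz (fun j => d j x) (fun j => e j x)).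
  apply (is_derive_sum_n (fun j y => d j y * e (k - j)%nat y)%C).
  intros j _; apply is_derive_Cmult; [now apply dS|now apply eS].
Qed.

Lemma jet_const r c : jet r (fun _ => c) (fun k _ => match k with O => c | S _ => 0%C end).
Proof.
split; [easy|]; intros k x _; rewrite Cmult_0_r.
destruct k; apply (is_derive_const (V := C_R_NormedModule)).
Qed.

Lemma jet_RtoC r :
  jet r RtoC (fun k x => match k with O => RtoC x | S O => 1%C | S (S _) => 0%C end).
Proof.
split; [easy|]; intros k x _; apply is_derive_C_iff; destruct k as [|[|k]]; simpl; split.
all: try rewrite !Rmult_0_r, ?Rmult_0_l, ?Rminus_0_r, ?Rplus_0_r.
all: try apply (is_derive_const (V := R_NormedModule)).
rewrite Rmult_1_r; apply (is_derive_id (K := R_AbsRing)).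
Qed.

Definition smooth_within (r : R) (f : R -> C) : Prop := exists d, jet r f d.

Definition jet_bound (M : nat -> R) (r : R) (n : nat) (A b : R) (f : R -> C) : Prop :=
  exists d, jet r f d /\
    forall k x, (k <= n)%nat -> Rabs x < r -> Cmod (d k x) <= A * b ^ k * damped M k.

Definition CM_within (M : nat -> R) (r : R) (f : R -> C) : Prop :=
  exists A b, 0 <= A /\ 1 <= b /\ forall n, jet_bound M r n A b f.

Lemma jet_bound_incr M r n A b A' b' f : DC_weight M -> 0 <= A <= A' -> 1 <= b <= b' ->
  jet_bound M r n A b f -> jet_bound M r n A' b' f.
Proof.
intros HM A_le b_le (d & jet_d & bound); exists d; split; [easy|]; intros k x k_le x_lt.
eapply Rle_trans; [now apply bound|].
pose proof (damped_pos M k HM); apply Rmult_le_compat_r; [lra|].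
apply Rmult_le_compat; [lra|apply pow_le; lra|lra|apply pow_incr; lra].
Qed.

Lemma jet_bound_restrict M r r' n A b f : r' <= r ->
  jet_bound M r n A b f -> jet_bound M r' n A b f.
Proof.
intros r_le (d & jet_d & bound); exists d; split; [now apply (jet_restrict r)|].
intros k x k_le x_lt; apply bound; [easy|lra].
Qed.

Lemma jet_bound_plus M r n A A' b f g :
  jet_bound M r n A b f -> jet_bound M r n A' b g ->
  jet_bound M r n (A + A') b (fun x => f x + g x)%C.
Proof.
intros (d & jet_d & d_le) (e & jet_e & e_le).
exists (fun k x => d k x + e k x)%C; split; [now apply jet_plus|]; intros k x k_le x_lt.
eapply Rle_trans; [apply Cmod_triangle|].
rewrite !Rmult_plus_distr_r; apply Rplus_le_compat; auto.
Qed.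

Lemma jet_bound_mult M r n A A' b f g : DC_weight M -> 0 <= A -> 0 <= A' -> 1 <= b ->
  jet_bound M r n A b f -> jet_bound M r n A' b g ->
  jet_bound M r n (8 * A * A') b (fun x => f x * g x)%C.
Proof.
intros HM A_ge A'_ge b_ge (d & jet_d & d_le) (e & jet_e & e_le).
exists (cauchy_product d e); split; [now apply jet_mult|]; intros k x k_le x_lt.
eapply Rle_trans; [apply Cmod_sum_n_le|].
apply Rle_trans with
  (sum_f_R0 (fun j => damped M j * damped M (k - j) * (A * A' * b ^ k)) k).
- apply sum_Rle; intros j j_le; rewrite Cmod_mult.
  replace (b ^ k) with (b ^ j * b ^ (k - j)) by (rewrite <- pow_add; f_equal; lia).
  replace (damped M j * damped M (k - j) * (A * A' * (b ^ j * b ^ (k - j)))) with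
    (A * b ^ j * damped M j * (A' * b ^ (k - j) * damped M (k - j))) by ring.
  apply Rmult_le_compat; try apply Cmod_ge_0; [apply d_le|apply e_le]; try lia; easy.
- rewrite <- scal_sum.
  replace (8 * A * A' * b ^ k * damped M k) with (A * A' * b ^ k * (8 * damped M k)) by ring.
  apply Rmult_le_compat_l; [|now apply damped_conv_le].
  apply Rmult_le_pos; [nra|apply pow_le; lra].
Qed.

Lemma jet_bound_primitive M r n A b a f phi : DC_weight M -> 0 <= A -> 1 <= b ->
  4 * A <= a * b ->
  (forall x, Rabs x < r -> is_derive f x (phi x)) ->
  (forall x, Rabs x < r -> Cmod (f x) <= a) ->
  jet_bound M r n A b phi -> jet_bound M r (S n) a b f.
Proof.
intros HM A_ge b_ge ab_ge df f_le (d & jet_d & d_le).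
exists (fun k x => match k with O => f x | S j => / INR (S j) * d j x end)%C.
split; [now apply (jet_primitive r f phi)|]; intros [|k] x k_le x_lt.
- rewrite damped_0, !Rmult_1_r by easy; auto.
- pose proof (INR_S_ge_1 k); pose proof (damped_pos M (S k) HM).
  pose proof (damped_le_succ M k HM); pose proof (pow_lt b k ltac:(lra)).
  rewrite Cmod_mult, Cmod_inv, Cmod_R, Rabs_pos_eq by (apply RtoC_INR_S_neq_0 || lra).
  apply Rle_trans with (1 * (A * b ^ k * damped M k)).
  { apply Rmult_le_compat; [left; apply Rinv_0_lt_compat; lra|apply Cmod_ge_0| |].
    - rewrite <- Rinv_1; apply Rinv_le_contravar; lra.
    - apply d_le; [lia|easy]. }
  apply Rle_trans with (4 * A * (b ^ k * damped M (S k))).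
  + replace (4 * A * (b ^ k * damped M (S k))) with (A * b ^ k * (4 * damped M (S k))) by ring.
    rewrite Rmult_1_l; apply Rmult_le_compat_l; [apply Rmult_le_pos; lra|easy].
  + replace (a * b ^ S k * damped M (S k)) with (a * b * (b ^ k * damped M (S k)))
      by (simpl; ring).
    apply Rmult_le_compat_r; [apply Rmult_le_pos; lra|easy].
Qed.

Lemma CM_within_smooth M r f : CM_within M r f -> smooth_within r f.
Proof.
intros (A & b & _ & _ & bound); destruct (bound 0%nat) as (d & jet_d & _); now exists d.
Qed.

Lemma CM_within_restrict M r r' f : r' <= r -> CM_within M r f -> CM_within M r' f.
Proof.
intros r_le (A & b & A_ge & b_ge & bound); exists A, b; repeat split; try easy.
intros n; now apply (jet_bound_restrict M r).
Qed.

Lemma CM_within_ext M r f g : (forall x, Rabs x < r -> f x = g x) ->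
  CM_within M r f -> CM_within M r g.
Proof.
intros fg (A & b & A_ge & b_ge & bound); exists A, b; repeat split; try easy; intros n.
destruct (bound n) as (d & jet_d & d_le); exists d; split; [now apply (jet_ext r f)|easy].
Qed.

Lemma CM_within_const M r c : DC_weight M -> CM_within M r (fun _ => c).
Proof.
intros HM; exists (Cmod c), 1; split; [apply Cmod_ge_0|split; [lra|]]; intros n.
eexists; split; [apply jet_const|]; intros [|k] x _ _; rewrite pow1.
- rewrite damped_0 by easy; lra.
- rewrite Cmod_0; pose proof (damped_pos M (S k) HM); pose proof (Cmod_ge_0 c); nra.
Qed.

Lemma CM_within_RtoC M r : DC_weight M -> CM_within M r RtoC.
Proof.
intros HM; exists (Rmax (Rabs r) (/ damped M 1)), 1.
pose proof (Rmax_l (Rabs r) (/ damped M 1)); pose proof (Rmax_r (Rabs r) (/ damped M 1)).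
pose proof (Rabs_pos r); pose proof (Rle_abs r).
split; [lra|split; [lra|]]; intros n.
eexists; split; [apply jet_RtoC|]; intros [|[|k]] x _ x_lt; rewrite pow1, Rmult_1_r.
- rewrite damped_0, Cmod_R by easy; lra.
- pose proof (damped_pos M 1 HM).
  rewrite Cmod_1, <- (Rinv_l (damped M 1)) by lra; apply Rmult_le_compat_r; lra.
- rewrite Cmod_0; pose proof (damped_pos M (S (S k)) HM); nra.
Qed.

Lemma CM_within_common_bound M r f g : DC_weight M -> CM_within M r f -> CM_within M r g ->
  exists A A' b, 0 <= A /\ 0 <= A' /\ 1 <= b /\
    forall n, jet_bound M r n A b f /\ jet_bound M r n A' b g.
Proof.
intros HM (A & b & A_ge & b_ge & f_bound) (A' & b' & A'_ge & b'_ge & g_bound).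
exists A, A', (Rmax b b'); pose proof (Rmax_l b b'); pose proof (Rmax_r b b').
repeat split; try lra.
- now apply (jet_bound_incr M r n A b); try lra.
- now apply (jet_bound_incr M r n A' b'); try lra.
Qed.

Lemma CM_within_plus M r f g : DC_weight M -> CM_within M r f -> CM_within M r g ->
  CM_within M r (fun x => f x + g x)%C.
Proof.
intros HM Hf Hg.
destruct (CM_within_common_bound M r f g HM Hf Hg) as (A & A' & b & A_ge & A'_ge & b_ge & bound).
exists (A + A'), b; repeat split; try lra; intros n; apply jet_bound_plus; apply bound.
Qed.

Lemma CM_within_mult M r f g : DC_weight M -> CM_within M r f -> CM_within M r g ->
  CM_within M r (fun x => f x * g x)%C.
Proof.
intros HM Hf Hg.
destruct (CM_within_common_bound M r f g HM Hf Hg) as (A & A' & b & A_ge & A'_ge & b_ge & bound).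
exists (8 * A * A'), b; repeat split; try lra; [nra|].
intros n; apply jet_bound_mult; try easy; apply bound.
Qed.

Lemma CM_within_of_succ_bound M r f g : DC_weight M -> CM_within M r f ->
  (forall d, jet r f d -> exists e, jet r g e /\
     forall k E, (forall x, Rabs x < r -> Cmod (d (S k) x) <= E) ->
     forall x, Rabs x < r -> Cmod (e k x) <= 2 * INR (S k) * E) ->
  CM_within M r g.
Proof.
intros HM (A & b & A_ge & b_ge & bound) jet_g.
destruct (damped_succ_le M HM) as (B & B_ge & succ_le).
exists (2 * A * b * B), (b * B); split; [repeat apply Rmult_le_pos; lra|split; [nra|]].
intros n; destruct (bound (S n)) as (d & jet_d & d_le).
destruct (jet_g d jet_d) as (e & jet_e & e_le).
exists e; split; [easy|]; intros k x k_le x_lt.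
eapply Rle_trans.
{ apply (e_le k (A * b ^ S k * damped M (S k))); [|easy].
  intros y y_lt; apply d_le; [lia|easy]. }
replace (2 * INR (S k) * (A * b ^ S k * damped M (S k))) with
  (2 * A * b ^ S k * (INR (S k) * damped M (S k))) by ring.
replace (2 * A * b * B * (b * B) ^ k * damped M k) with
  (2 * A * b ^ S k * (B ^ S k * damped M k)) by (rewrite Rpow_mult_distr; simpl; ring).
apply Rmult_le_compat_l; [|apply succ_le].
repeat apply Rmult_le_pos; try apply pow_le; lra.
Qed.

Lemma CM_within_derive M r f : DC_weight M -> CM_within M r f ->
  exists f', CM_within M r f' /\ forall x, Rabs x < r -> is_derive f x (f' x).
Proof.
intros HM Hf; destruct (CM_within_smooth M r f Hf) as [d jet_d].
exists (d 1%nat); split; [|intros x x_lt; now apply (jet_is_derive r)].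
apply (CM_within_of_succ_bound M r f); try easy; intros d' jet_d'.
exists (fun k x => INR (S k) * d' (S k) x)%C; split.
- apply (jet_ext r (d' 1%nat)); [|now apply (jet_tail r f)].
  now apply (jet_unique r f).
- intros k E E_ge x x_lt; specialize (E_ge x x_lt).
  rewrite Cmod_mult, Cmod_R, Rabs_pos_eq by apply pos_INR.
  pose proof (INR_S_pos k); pose proof (Cmod_ge_0 (d' (S k) x)); nra.
Qed.

Record function_algebra (P : (R -> C) -> Prop) : Prop := {
  algebra_const : forall c, P (fun _ => c);
  algebra_plus : forall f g, P f -> P g -> P (fun x => f x + g x)%C;
  algebra_mult : forall f g, P f -> P g -> P (fun x => f x * g x)%C }.

Lemma function_algebra_CM_within M r : DC_weight M -> function_algebra (CM_within M r).
Proof.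
intros HM; split; intros;
  [now apply CM_within_const|now apply CM_within_plus|now apply CM_within_mult].
Qed.

Lemma function_algebra_smooth_within r : function_algebra (smooth_within r).
Proof.
split.
- intros c; eexists; apply jet_const.
- intros f g [d jet_d] [e jet_e]; eexists; apply jet_plus; eassumption.
- intros f g [d jet_d] [e jet_e]; eexists; apply jet_mult; eassumption.
Qed.

(* Iterating a choice of derivative inside [P] produces a jet. *)
Lemma smooth_within_of_derive_closed r (P : (R -> C) -> Prop) :
  (forall f, P f -> exists f', P f' /\ forall x, Rabs x < r -> is_derive f x (f' x)) ->
  forall f, P f -> smooth_within r f.
Proof.
intros closed.
destruct (functional_choice
  (fun f f' : {f | P f} => forall x, Rabs x < r -> is_derive (proj1_sig f) x (proj1_sig f' x)))
  as [D D_derive].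
{ intros [f Pf]; destruct (closed f Pf) as (f' & Pf' & df); now exists (exist _ f' Pf'). }
intros f Pf; pose (F k := Nat.iter k D (exist _ f Pf)).
exists (fun k x => / INR (fact k) * proj1_sig (F k) x)%C; split.
- intros x _; simpl; field.
- intros k x x_lt.
  replace (INR (S k) * (/ INR (fact (S k)) * proj1_sig (F (S k)) x))%C with
    (/ INR (fact k) * proj1_sig (F (S k)) x)%C.
  + now apply is_derive_Cscal, (D_derive (F k)).
  + rewrite INR_fact_S, RtoC_mult.
    field; split; [apply RtoC_neq_0, INR_fact_neq_0|apply RtoC_INR_S_neq_0].
Qed.

(** * Germs at the origin *)

Lemma at_right_0_of_restrict (P : R -> Prop) :
  (forall r r', r' <= r -> P r -> P r') -> (exists r, 0 < r /\ P r) -> at_right 0 P.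
Proof.
intros restrict (r & r_pos & Pr); exists (mkposreal r r_pos); intros r' r'_near _.
apply (restrict r); [|easy].
apply Rabs_def2 in r'_near; change (minus r' 0) with (r' - 0) in r'_near; simpl in r'_near; lra.
Qed.

Lemma at_right_0_ex (P : R -> Prop) : at_right 0 P -> exists r, 0 < r /\ P r.
Proof.
intros P_small; apply (filter_ex (F := at_right 0)).
apply filter_and; [|exact P_small].
exists (mkposreal 1 Rlt_0_1); now intros.
Qed.

Lemma locally_0_iff (P : R -> Prop) :
  locally 0 P <-> at_right 0 (fun r => forall x, Rabs x < r -> P x).
Proof.
split.
- intros [r P_ball]; apply at_right_0_of_restrict.
  + intros r1 r2 r_le P1 x x_lt; apply P1; lra.
  + exists r; split; [apply cond_pos|]; intros x x_lt; apply P_ball.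
    change (Rabs (x - 0) < r); now rewrite Rminus_0_r.
- intros P_small; destruct (at_right_0_ex _ P_small) as (r & r_pos & P_ball).
  exists (mkposreal r r_pos); intros x x_near; apply P_ball.
  change (Rabs (x - 0) < r) in x_near; now rewrite Rminus_0_r in x_near.
Qed.

Definition smooth_germ (f : R -> C) : Prop := at_right 0 (fun r => smooth_within r f).

Definition CM_germ (M : nat -> R) (f : R -> C) : Prop := at_right 0 (fun r => CM_within M r f).

Lemma smooth_germ_of_within r f : 0 < r -> smooth_within r f -> smooth_germ f.
Proof.
intros r_pos Hf; apply at_right_0_of_restrict; [|now exists r].
intros r1 r2 r_le [d jet_d]; exists d; now apply (jet_restrict r1).
Qed.

Lemma CM_germ_of_within M r f : 0 < r -> CM_within M r f -> CM_germ M f.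
Proof.
intros r_pos Hf; apply at_right_0_of_restrict; [|now exists r].
intros r1 r2; apply CM_within_restrict.
Qed.

Lemma CM_germ_smooth M f : CM_germ M f -> smooth_germ f.
Proof. apply (filter_imp (F := at_right 0)); intros r; apply CM_within_smooth. Qed.

Lemma at_right_0_ext_loc (P : R -> (R -> C) -> Prop) f g :
  (forall r, (forall x, Rabs x < r -> f x = g x) -> P r f -> P r g) ->
  locally 0 (fun t => f t = g t) ->
  at_right 0 (fun r => P r f) -> at_right 0 (fun r => P r g).
Proof.
intros P_ext fg Pf; apply locally_0_iff in fg.
generalize (filter_and _ _ fg Pf); apply filter_imp; intros r [fg_r Pf_r]; auto.
Qed.

Lemma smooth_germ_ext_loc f g : locally 0 (fun t => f t = g t) -> smooth_germ f -> smooth_germ g.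
Proof.
apply at_right_0_ext_loc; intros r fg [d jet_d]; exists d; now apply (jet_ext r f).
Qed.

Lemma CM_germ_ext_loc M f g : locally 0 (fun t => f t = g t) -> CM_germ M f -> CM_germ M g.
Proof. apply at_right_0_ext_loc; intros r; apply CM_within_ext. Qed.

Lemma function_algebra_at_right (P : R -> (R -> C) -> Prop) :
  (forall r, function_algebra (P r)) -> function_algebra (fun f => at_right 0 (fun r => P r f)).
Proof.
intros HP; split.
- intros c; apply filter_forall; intros r; apply (HP r).
- intros f g Hf Hg; generalize (filter_and _ _ Hf Hg); apply filter_imp.
  intros r [Pf Pg]; now apply (HP r).
- intros f g Hf Hg; generalize (filter_and _ _ Hf Hg); apply filter_imp.
  intros r [Pf Pg]; now apply (HP r).
Qed.

Lemma function_algebra_smooth_germ : function_algebra smooth_germ.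
Proof. apply function_algebra_at_right, function_algebra_smooth_within. Qed.

Lemma function_algebra_CM_germ M : DC_weight M -> function_algebra (CM_germ M).
Proof.
intros HM; apply function_algebra_at_right; intros r; now apply function_algebra_CM_within.
Qed.

Lemma CM_germ_RtoC M : DC_weight M -> CM_germ M RtoC.
Proof.
intros HM; apply (filter_forall (F := at_right 0)); intros r; now apply CM_within_RtoC.
Qed.

Lemma smooth_germ_RtoC : smooth_germ RtoC.
Proof. apply (filter_forall (F := at_right 0)); intros r; eexists; apply jet_RtoC. Qed.

Lemma algebra_pow P f n : function_algebra P -> P f -> P (fun t => f t ^ n)%C.
Proof.
intros HP Pf; induction n as [|n IH]; [apply (algebra_const P HP 1%C)|].
now apply (algebra_mult P HP f (fun t => f t ^ n)%C).
Qed.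

Lemma smooth_germ_continuous f : smooth_germ f -> continuous f 0.
Proof.
intros Hf; destruct (at_right_0_ex _ Hf) as (r & r_pos & d & jet_d).
apply (ex_derive_continuous (V := C_R_NormedModule)); exists (d 1%nat 0).
apply (jet_is_derive r); [easy|now rewrite Rabs_R0].
Qed.

Lemma continuous_Cmod_near (f : R -> C) x e : continuous f x -> 0 < e ->
  locally x (fun t => Cmod (f t - f x)%C < e).
Proof.
intros f_cont e_pos; apply (f_cont (fun z => Cmod (z - f x)%C < e)).
exists (mkposreal (e / 2) ltac:(lra)); intros z [fst_near snd_near].
change (Rabs (fst z - fst (f x)) < e / 2) in fst_near.
change (Rabs (snd z - snd (f x)) < e / 2) in snd_near.
eapply Rle_lt_trans; [apply Cmod_le_add_Rabs|simpl; unfold Rminus in *; lra].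
Qed.

Lemma continuous_Cmod_bounded (f : R -> C) x : continuous f x ->
  locally x (fun t => Cmod (f t) <= Cmod (f x) + 1).
Proof.
intros f_cont; generalize (continuous_Cmod_near f x 1 f_cont Rlt_0_1); apply filter_imp.
intros t near; replace (f t) with (f x + (f t - f x))%C by ring.
eapply Rle_trans; [apply Cmod_triangle|lra].
Qed.

Lemma continuous_Cmod_bounded_below (f : R -> C) x : continuous f x -> f x <> 0%C ->
  locally x (fun t => Cmod (f x) / 2 <= Cmod (f t)).
Proof.
intros f_cont fx; apply Cmod_gt_0 in fx.
generalize (continuous_Cmod_near f x (Cmod (f x) / 2) f_cont ltac:(lra)); apply filter_imp.
intros t near; enough (Cmod (f x) <= Cmod (f t) + Cmod (f t - f x)%C) by lra.
replace (f x) with (f t + - (f t - f x))%C at 1 by ring.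
eapply Rle_trans; [apply Cmod_triangle|]; rewrite Cmod_opp; lra.
Qed.

Lemma continuous_neq_0_locally (f : R -> C) x : continuous f x -> f x <> 0%C ->
  locally x (fun t => f t <> 0%C).
Proof.
intros f_cont fx; generalize (continuous_Cmod_bounded_below f x f_cont fx); apply filter_imp.
apply Cmod_gt_0 in fx; intros t below ft0; rewrite ft0, Cmod_0 in below; lra.
Qed.

(** * Division by the coordinate *)

Lemma RInt_R_ext (f g : R -> R) a b :
  (forall x, Rmin a b < x < Rmax a b -> f x = g x) -> RInt f a b = RInt g a b.
Proof. exact (RInt_ext f g a b). Qed.

Lemma RInt_Rmult_l c (f : R -> R) a b :
  ex_RInt f a b -> RInt (fun x => c * f x) a b = c * RInt f a b.
Proof. exact (RInt_scal f a b c). Qed.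

Section Hadamard.

Variables (r : R) (d : nat -> R -> R).
Hypothesis d_derive : forall k x, Rabs x < r -> is_derive (d k) x (INR (S k) * d (S k) x).

(* The jet of the quotient (d 0 x - d 0 0) / x: differentiate Hadamard's formula, the
   integral of f'(s x) over 0 <= s <= 1, under the integral sign. *)
Definition hadamard (k : nat) (x : R) : R :=
  RInt (fun s => INR (S k) * s ^ k * d (S k) (s * x)) 0 1.

Let integrand_derive (k : nat) (x s : R) : R :=
  INR (S k) * s ^ k * (s * (INR (S (S k)) * d (S (S k)) (s * x))).

Lemma Rabs_scale_lt s x : Rmin 0 1 <= s <= Rmax 0 1 -> Rabs x < r -> Rabs (s * x) < r.
Proof.
rewrite Rmin_left, Rmax_right by lra; intros s_in x_lt.
rewrite Rabs_mult, (Rabs_pos_eq s) by lra; pose proof (Rabs_pos x); nra.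
Qed.

Lemma jet_term_continuous k x : Rabs x < r -> continuous (d k) x.
Proof.
intros x_lt; apply (ex_derive_continuous (K := R_AbsRing) (V := R_NormedModule)).
eexists; now apply d_derive.
Qed.

Lemma hadamard_ex_RInt k x : Rabs x < r ->
  ex_RInt (fun s => INR (S k) * s ^ k * d (S k) (s * x)) 0 1.
Proof.
intros x_lt; apply (ex_RInt_continuous (V := R_CompleteNormedModule)); intros s s_in.
apply (continuous_mult (K := R_AbsRing) (fun s => INR (S k) * s ^ k) (fun s => d (S k) (s * x))).
- apply (ex_derive_continuous (V := R_NormedModule)); auto_derive; easy.
- apply (continuous_comp (fun s => s * x) (d (S k))).
  + apply (ex_derive_continuous (V := R_NormedModule)); auto_derive; easy.
  + now apply jet_term_continuous, Rabs_scale_lt.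
Qed.

Lemma hadamard_integrand_derive k x s : Rabs (s * x) < r ->
  is_derive (fun y => INR (S k) * s ^ k * d (S k) (s * y)) x (integrand_derive k x s).
Proof.
intros sx_lt; apply (is_derive_scal (fun y => d (S k) (s * y)) x (INR (S k) * s ^ k)).
apply (is_derive_comp (d (S k)) (fun y => s * y)); [now apply d_derive|].
auto_derive; [easy|ring].
Qed.

Lemma hadamard_integrand_derive_continuous k x s : Rabs (s * x) < r ->
  continuity_2d_pt
    (fun u v => Derive (fun y => INR (S k) * v ^ k * d (S k) (v * y)) u) x s.
Proof.
intros sx_lt.
assert (scale_continuous : continuity_2d_pt (fun u v => v * u) x s).
{ apply continuity_2d_pt_mult; [apply continuity_2d_pt_id2|apply continuity_2d_pt_id1]. }
apply (continuity_2d_pt_ext_loc (fun u v => integrand_derive k u v)).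
- generalize (scale_continuous (mkposreal (r - Rabs (s * x)) ltac:(lra))).
  apply locally_2d_impl, locally_2d_forall; intros u v uv_near; simpl in uv_near.
  symmetry; apply is_derive_unique, hadamard_integrand_derive.
  pose proof (Rabs_triang_inv (v * u) (s * x)); lra.
- apply continuity_2d_pt_mult.
  + apply (continuity_1d_2d_pt_comp (fun w => INR (S k) * w ^ k) (fun _ v => v));
      [reg|apply continuity_2d_pt_id2].
  + apply continuity_2d_pt_mult; [apply continuity_2d_pt_id2|].
    apply continuity_2d_pt_mult; [apply continuity_2d_pt_const|].
    apply (continuity_1d_2d_pt_comp (d (S (S k))) (fun u v => v * u)); [|exact scale_continuous].
    now apply continuity_pt_filterlim, jet_term_continuous.
Qed.

Lemma hadamard_is_derive k x : Rabs x < r ->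
  is_derive (hadamard k) x (INR (S k) * hadamard (S k) x).
Proof.
intros x_lt.
replace (INR (S k) * hadamard (S k) x) with
  (RInt (fun s => Derive (fun y => INR (S k) * s ^ k * d (S k) (s * y)) x) 0 1).
- apply is_derive_RInt_param.
  + generalize (locally_Rabs_lt x r x_lt); apply filter_imp; intros y y_lt s s_in.
    eexists; now apply hadamard_integrand_derive, Rabs_scale_lt.
  + intros s s_in; now apply hadamard_integrand_derive_continuous, Rabs_scale_lt.
  + generalize (locally_Rabs_lt x r x_lt); apply filter_imp; intros y y_lt.
    now apply hadamard_ex_RInt.
- unfold hadamard; rewrite <- RInt_Rmult_l by now apply hadamard_ex_RInt.
  apply RInt_R_ext; intros s s_in.
  transitivity (integrand_derive k x s); [|unfold integrand_derive; simpl pow; ring].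
  apply is_derive_unique, hadamard_integrand_derive, Rabs_scale_lt; lra.
Qed.

Lemma hadamard_le k E x : Rabs x < r -> (forall y, Rabs y < r -> Rabs (d (S k) y) <= E) ->
  Rabs (hadamard k x) <= INR (S k) * E.
Proof.
intros x_lt d_le; unfold hadamard.
replace (INR (S k) * E) with ((1 - 0) * (INR (S k) * E)) by ring.
apply abs_RInt_le_const; [lra|now apply hadamard_ex_RInt|intros s s_in].
rewrite !Rabs_mult, <- RPow_abs, (Rabs_pos_eq s), (Rabs_pos_eq (INR _)) by (apply pos_INR || lra).
pose proof (INR_S_pos k); pose proof (pow_incr s 1 k ltac:(lra)) as pow_le_1.
rewrite pow1 in pow_le_1; pose proof (pow_le s k ltac:(lra)).
specialize (d_le (s * x) ltac:(apply Rabs_scale_lt; [rewrite Rmin_left, Rmax_right|]; lra)).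
rewrite Rmult_assoc; apply Rmult_le_compat_l; [lra|].
pose proof (Rabs_pos (d (S k) (s * x))); nra.
Qed.

Lemma hadamard_eq x : Rabs x < r -> d 0%nat x = d 0%nat 0 + x * hadamard 0 x.
Proof.
intros x_lt.
assert (FTC : is_RInt (fun s => x * d 1%nat (s * x)) 0 1
                (minus (d 0%nat (1 * x)) (d 0%nat (0 * x)))).
{ apply (is_RInt_derive (fun s => d 0%nat (s * x))).
  - intros s s_in.
    replace (x * d 1%nat (s * x)) with (scal x (INR 1 * d 1%nat (s * x)))
      by (change (x * (INR 1 * d 1%nat (s * x)) = x * d 1%nat (s * x)); simpl; ring).
    apply (is_derive_comp (d 0%nat) (fun s => s * x)); [now apply d_derive, Rabs_scale_lt|].
    auto_derive; [easy|ring].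
  - intros s s_in; apply (continuous_scal_r (K := R_AbsRing) x (fun s => d 1%nat (s * x))).
    apply (continuous_comp (fun s => s * x) (d 1%nat)).
    + apply (ex_derive_continuous (V := R_NormedModule)); auto_derive; easy.
    + now apply jet_term_continuous, Rabs_scale_lt. }
apply (is_RInt_unique (V := R_CompleteNormedModule)) in FTC; rewrite Rmult_1_l, Rmult_0_l in FTC.
assert (factor : RInt (fun s => x * d 1%nat (s * x)) 0 1 = x * hadamard 0 x).
{ unfold hadamard; rewrite <- RInt_Rmult_l by now apply hadamard_ex_RInt.
  apply RInt_R_ext; intros s _; simpl; ring. }
rewrite <- factor, FTC; change (minus ?u ?v) with (u - v); ring.
Qed.

End Hadamard.

Lemma jet_hadamard r f d : jet r f d ->
  exists e, jet r (e 0%nat) e /\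
    (forall x, Rabs x < r -> f x = f 0 + RtoC x * e 0%nat x)%C /\
    forall k E, (forall x, Rabs x < r -> Cmod (d (S k) x) <= E) ->
      forall x, Rabs x < r -> Cmod (e k x) <= 2 * INR (S k) * E.
Proof.
intros [d0 dS].
pose (re k x := fst (d k x)); pose (im k x := snd (d k x)).
assert (re_derive : forall k x, Rabs x < r -> is_derive (re k) x (INR (S k) * re (S k) x)).
{ intros k x x_lt; replace (INR (S k) * re (S k) x) with (fst (INR (S k) * d (S k) x)%C)
    by (unfold re; simpl; ring).
  now apply is_derive_C_iff, dS. }
assert (im_derive : forall k x, Rabs x < r -> is_derive (im k) x (INR (S k) * im (S k) x)).
{ intros k x x_lt; replace (INR (S k) * im (S k) x) with (snd (INR (S k) * d (S k) x)%C)
    by (unfold im; simpl; ring).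
  now apply is_derive_C_iff, dS. }
exists (fun k x => (hadamard re k x, hadamard im k x)); split; [split; [easy|]|split].
- intros k x x_lt; apply is_derive_C_iff.
  replace (INR (S k) * (hadamard re (S k) x, hadamard im (S k) x))%C with
    (INR (S k) * hadamard re (S k) x, INR (S k) * hadamard im (S k) x)
    by (apply injective_projections; simpl; ring).
  split; now apply (hadamard_is_derive r).
- intros x x_lt; rewrite <- !d0 by (rewrite ?Rabs_R0; pose proof (Rabs_pos x); lra).
  pose proof (hadamard_eq r re re_derive x x_lt).
  pose proof (hadamard_eq r im im_derive x x_lt).
  apply injective_projections; simpl; unfold re, im in *; lra.
- intros k E d_le x x_lt; eapply Rle_trans; [apply Cmod_le_add_Rabs|].
  assert (Rabs (hadamard re k x) <= INR (S k) * E).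
  { apply (hadamard_le r); try easy; intros y y_lt.
    eapply Rle_trans; [apply Rabs_fst_le_Cmod|now apply d_le]. }
  assert (Rabs (hadamard im k x) <= INR (S k) * E).
  { apply (hadamard_le r); try easy; intros y y_lt.
    eapply Rle_trans; [apply Rabs_snd_le_Cmod|now apply d_le]. }
  cbn [fst snd]; lra.
Qed.

Lemma smooth_germ_hadamard f : smooth_germ f ->
  exists g, smooth_germ g /\ locally 0 (fun t => f t = f 0 + RtoC t * g t)%C.
Proof.
intros Hf; destruct (at_right_0_ex _ Hf) as (r & r_pos & d & jet_d).
destruct (jet_hadamard r f d jet_d) as (e & jet_e & f_eq & _).
exists (e 0%nat); split.
- apply (smooth_germ_of_within r); [easy|now exists e].
- generalize (locally_Rabs_lt 0 r ltac:(now rewrite Rabs_R0)); now apply filter_imp.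
Qed.

Lemma CM_germ_hadamard M f : DC_weight M -> CM_germ M f ->
  exists g, CM_germ M g /\ locally 0 (fun t => f t = f 0 + RtoC t * g t)%C.
Proof.
intros HM Hf; destruct (at_right_0_ex _ Hf) as (r & r_pos & Hf_r).
destruct (CM_within_smooth M r f Hf_r) as [d jet_d].
destruct (jet_hadamard r f d jet_d) as (e & jet_e & f_eq & e_le).
exists (e 0%nat); split.
- apply (CM_germ_of_within M r); [easy|].
  apply (CM_within_of_succ_bound M r f); try easy; intros d' jet_d'; exists e; split; [easy|].
  intros k E d'_le; apply e_le; intros x x_lt.
  rewrite (jet_unique r f d d') by easy; now apply d'_le.
- generalize (locally_Rabs_lt 0 r ltac:(now rewrite Rabs_R0)); now apply filter_imp.
Qed.

Lemma eq_at_0_of_punctured (f g : R -> C) : continuous f 0 -> continuous g 0 ->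
  locally' 0 (fun t => f t = g t) -> f 0 = g 0.
Proof.
intros f_cont g_cont fg.
assert (punctured_lim : forall h : R -> C, continuous h 0 ->
   filterlim h (Rbar_locally' 0) (locally (h 0))).
{ intros h h_cont P P_near; generalize (h_cont P P_near).
  now apply (filter_imp (F := locally 0)). }
apply (filterlim_locally_unique (V := C_R_NormedModule) (F := Rbar_locally' 0) f).
- now apply punctured_lim.
- apply (filterlim_ext_loc (F := Rbar_locally' 0) g).
  + generalize fg; apply filter_imp; intros t E; now symmetry.
  + now apply punctured_lim.
Qed.

Lemma eq_locally_of_punctured (f g : R -> C) : continuous f 0 -> continuous g 0 ->
  locally' 0 (fun t => f t = g t) -> locally 0 (fun t => f t = g t).
Proof.
intros f_cont g_cont fg; pose proof (eq_at_0_of_punctured f g f_cont g_cont fg) as fg0.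
generalize fg; apply (filter_imp (F := locally 0)); intros t E.
destruct (Req_dec t 0) as [->|t_neq]; auto.
Qed.

Lemma CM_germ_div_pow M f g n : DC_weight M -> CM_germ M f -> smooth_germ g ->
  locally 0 (fun t => f t = RtoC t ^ n * g t)%C -> CM_germ M g.
Proof.
intros HM Hf Hg; revert f Hf; induction n as [|n IH]; intros f Hf fg.
- apply (CM_germ_ext_loc M f); [|easy].
  generalize fg; apply filter_imp; intros t ->; simpl; ring.
- assert (f0 : f 0 = 0%C) by (rewrite (locally_singleton _ _ fg); simpl; ring).
  destruct (CM_germ_hadamard M f HM Hf) as (h & Hh & fh).
  apply (IH h Hh), eq_locally_of_punctured.
  + now apply smooth_germ_continuous, (CM_germ_smooth M).
  + apply smooth_germ_continuous.
    apply (algebra_mult _ function_algebra_smooth_germ (fun t => RtoC t ^ n)%C); [|easy].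
    apply algebra_pow, smooth_germ_RtoC; apply function_algebra_smooth_germ.
  + generalize (filter_and _ _ fg fh); apply (filter_imp (F := locally 0)).
    intros t [ft_g ft_h] t_neq; apply RtoC_neq_0 in t_neq; rewrite f0, Cplus_0_l in ft_h.
    apply (Cmult_eq_reg_l (RtoC t)); [easy|].
    rewrite <- ft_h, ft_g; simpl; ring.
Qed.

Lemma smooth_germ_taylor M f n : DC_weight M -> smooth_germ f ->
  exists T g, CM_germ M T /\ smooth_germ g /\ locally 0 (fun t => f t = T t + RtoC t ^ n * g t)%C.
Proof.
intros HM; pose proof (function_algebra_CM_germ M HM) as CM_alg.
revert f; induction n as [|n IH]; intros f Hf.
- exists (fun _ => 0%C), f; split; [now apply algebra_const|split; [easy|]].
  apply filter_forall; intros t; simpl; ring.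
- destruct (smooth_germ_hadamard f Hf) as (g & Hg & fg).
  destruct (IH g Hg) as (T & h & HT & Hh & gh).
  exists (fun t => f 0 + RtoC t * T t)%C, h; split; [|split; [easy|]].
  + apply (algebra_plus _ CM_alg (fun _ => f 0)); [now apply algebra_const|].
    apply algebra_mult; [easy|now apply CM_germ_RtoC|easy].
  + generalize (filter_and _ _ fg gh); apply filter_imp; intros t [-> ->]; simpl; ring.
Qed.

(** * Flat germs and germs of finite order *)

Definition flat_germ (f : R -> C) : Prop :=
  forall n, exists g, smooth_germ g /\ locally 0 (fun t => f t = RtoC t ^ n * g t)%C.

Definition finite_order (f : R -> C) : Prop :=
  exists n u, smooth_germ u /\ u 0 <> 0%C /\ locally 0 (fun t => f t = RtoC t ^ n * u t)%C.

Lemma flat_germ_0 f : flat_germ f -> f 0 = 0%C.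
Proof.
intros f_flat; destruct (f_flat 1%nat) as (g & _ & fg).
rewrite (locally_singleton _ _ fg); simpl; ring.
Qed.

Lemma finite_order_or_flat f : smooth_germ f -> finite_order f \/ flat_germ f.
Proof.
intros Hf; destruct (classic (finite_order f)) as [|not_finite]; [now left|right].
intros n; induction n as [|n (g & Hg & fg)].
- exists f; split; [easy|apply filter_forall; intros t; simpl; ring].
- assert (g0 : g 0 = 0%C) by (apply NNPP; intros g0; apply not_finite; now exists n, g).
  destruct (smooth_germ_hadamard g Hg) as (h & Hh & gh).
  exists h; split; [easy|].
  generalize (filter_and _ _ fg gh); apply filter_imp; intros t [-> ->].
  rewrite g0; simpl; ring.
Qed.

Lemma finite_order_neq_0 f : finite_order f -> locally' 0 (fun t => f t <> 0%C).
Proof.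
intros (n & u & Hu & u0 & fu).
pose proof (continuous_neq_0_locally u 0 (smooth_germ_continuous u Hu) u0) as u_neq.
generalize (filter_and _ _ fu u_neq); apply (filter_imp (F := locally 0)).
intros t [-> ut_neq] t_neq; apply Cmult_neq_0; [|easy].
now apply Cpow_nz, RtoC_neq_0.
Qed.

Lemma finite_order_mult f g : finite_order f -> finite_order g ->
  finite_order (fun t => f t * g t)%C.
Proof.
intros (n & u & Hu & u0 & fu) (m & v & Hv & v0 & gv).
exists (n + m)%nat, (fun t => u t * v t)%C; split; [|split; [now apply Cmult_neq_0|]].
- now apply algebra_mult; [apply function_algebra_smooth_germ| |].
- generalize (filter_and _ _ fu gv); apply filter_imp; intros t [-> ->].
  rewrite Cpow_add_r; ring.
Qed.

Lemma flat_germ_mult f g : flat_germ f -> smooth_germ g -> flat_germ (fun t => f t * g t)%C.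
Proof.
intros f_flat Hg n; destruct (f_flat n) as (h & Hh & fh).
exists (fun t => h t * g t)%C; split.
- now apply algebra_mult; [apply function_algebra_smooth_germ| |].
- generalize fh; apply filter_imp; intros t ->; ring.
Qed.

Lemma finite_order_plus_flat f g : finite_order f -> flat_germ g ->
  finite_order (fun t => f t + g t)%C.
Proof.
intros (n & u & Hu & u0 & fu) g_flat; destruct (g_flat (S n)) as (v & Hv & gv).
pose proof function_algebra_smooth_germ as alg.
exists n, (fun t => u t + RtoC t * v t)%C; split; [|split].
- apply (algebra_plus _ alg u); [easy|]; now apply algebra_mult; [|apply smooth_germ_RtoC|].
- now rewrite Cmult_0_l, Cplus_0_r.
- generalize (filter_and _ _ fu gv); apply filter_imp; intros t [-> ->]; simpl; ring.
Qed.

Lemma jet_RtoC_mult r h e : jet r h e ->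
  jet r (fun t => RtoC t * h t)%C
    (fun k t => match k with O => RtoC t * e O t | S j => RtoC t * e (S j) t + e j t end)%C.
Proof.
intros [e0 eS].
assert (mult_derive : forall k x, Rabs x < r ->
  is_derive (fun t => RtoC t * e k t)%C x (e k x + RtoC x * (INR (S k) * e (S k) x))%C).
{ intros k x x_lt; rewrite <- (Cmult_1_l (e k x)).
  apply is_derive_Cmult; [|now apply eS].
  exact (jet_is_derive r RtoC _ x (jet_RtoC r) x_lt). }
split; [intros x x_lt; now rewrite e0|]; intros [|k] x x_lt.
- replace (INR 1 * (RtoC x * e 1%nat x + e 0%nat x))%C with
    (e 0%nat x + RtoC x * (INR 1 * e 1%nat x))%C by (simpl; ring); now apply mult_derive.
- replace (INR (S (S k)) * (RtoC x * e (S (S k)) x + e (S k) x))%C with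
    (e (S k) x + RtoC x * (INR (S (S k)) * e (S (S k)) x) + INR (S k) * e (S k) x)%C
    by (rewrite (S_INR (S k)), RtoC_plus; ring).
  exact (is_derive_plus _ _ _ _ _ (mult_derive (S k) x x_lt) (eS k x x_lt)).
Qed.

Lemma jet_0_of_div_pow n : forall r f d g, 0 < r -> jet r f d -> smooth_germ g ->
  locally 0 (fun t => f t = RtoC t ^ n * g t)%C -> forall k, (k < n)%nat -> d k 0 = 0%C.
Proof.
induction n as [|n IH]; intros r f d g r_pos jet_d Hg fg k k_lt; [lia|].
assert (Hh : smooth_germ (fun t => RtoC t ^ n * g t)%C).
{ apply (algebra_mult _ function_algebra_smooth_germ (fun t => RtoC t ^ n)%C); [|easy].
  apply algebra_pow, smooth_germ_RtoC; apply function_algebra_smooth_germ. }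
apply locally_0_iff in fg.
destruct (at_right_0_ex _ (filter_and _ _ fg Hh)) as (r' & r'_pos & fg' & e & jet_e).
pose proof (Rmin_l r r'); pose proof (Rmin_r r r').
assert (min_pos : Rabs 0 < Rmin r r') by (rewrite Rabs_R0; now apply Rmin_pos).
apply (jet_restrict r (Rmin r r')) in jet_d; [|easy].
apply (jet_restrict r' (Rmin r r')) in jet_e as jet_e'; [|easy].
apply jet_RtoC_mult in jet_e'.
apply (jet_ext _ _ f) in jet_e'; [|intros x x_lt; rewrite fg' by lra; simpl; ring].
rewrite (jet_unique _ _ _ _ jet_d jet_e' k 0 min_pos).
destruct k as [|k]; [ring|].
rewrite (IH r' _ e g r'_pos jet_e Hg ltac:(apply filter_forall; now intros) k ltac:(lia)); ring.
Qed.

(** * The Denjoy-Carleman theorem *)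

Definition unbounded_sums (a : nat -> R) : Prop := forall B, exists N, B < sum_f_R0 a N.

Lemma unbounded_sums_tail a n : unbounded_sums a -> unbounded_sums (fun i => a (n + i)%nat).
Proof.
intros unbounded; induction n as [|n IH]; [easy|]; intros B.
destruct (IH (a n + Rmax B 0)) as [[|N] sum_gt]; pose proof (Rmax_l B 0); pose proof (Rmax_r B 0).
- exfalso; simpl in sum_gt; rewrite Nat.add_0_r in sum_gt; lra.
- exists N; rewrite decomp_sum in sum_gt by lia; rewrite Nat.add_0_r in sum_gt.
  rewrite (sum_eq (fun i => a (S n + i)%nat) (fun i => a (n + S i)%nat)); [simpl in *; lra|].
  intros i _; f_equal; lia.
Qed.

Definition bang_step (M : nat -> R) (n : nat) : R := M n / (INR (S n) * M (S n)).

Lemma bang_step_pos M n : log_convex M -> 0 < bang_step M n.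
Proof.
intros [pos _]; apply Rdiv_lt_0_compat; [apply pos|].
apply Rmult_lt_0_compat; [apply INR_S_pos|apply pos].
Qed.

Lemma bang_step_le M k n : log_convex M -> (k <= n)%nat ->
  INR (S k) * M (S k) * bang_step M n <= M k.
Proof.
intros HM k_le; pose proof (proj1 HM) as pos.
pose proof (log_convex_ratio_incr M HM k (n - k)) as ratio.
replace (k + (n - k))%nat with n in ratio by lia.
assert (INR_le : INR (S k) <= INR (S n)) by (apply le_INR; lia).
pose proof (INR_S_pos k); pose proof (INR_S_pos n); pose proof (pos k); pose proof (pos n).
pose proof (pos (S k)); pose proof (pos (S n)).
apply Rmult_le_reg_r with (INR (S n) * M (S n)); [nra|].
replace (INR (S k) * M (S k) * bang_step M n * (INR (S n) * M (S n))) with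
  (INR (S k) * (M (S k) * M n)) by (unfold bang_step; field; lra).
replace (M k * (INR (S n) * M (S n))) with (INR (S n) * (M k * M (S n))) by ring.
apply Rmult_le_compat; nra.
Qed.

Section Bang.

Variables (M : nat -> R) (r A b : R) (d : nat -> R -> C).
Hypothesis HM : log_convex M.
Hypothesis A_ge : 0 <= A.
Hypothesis b_pos : 0 < b.
Hypothesis d_derive : forall k x, Rabs x < r -> is_derive (d k) x (INR (S k) * d (S k) x)%C.
Hypothesis d_le : forall k x, Rabs x < r -> Cmod (d k x) <= A * b ^ k * M k.

Definition bang_level (n : nat) (x : R) : Prop :=
  forall k, Cmod (d k x) * 2 ^ n <= A * b ^ k * M k * 2 ^ k.

Let majorant_pos k : 0 <= A * b ^ k * M k.
Proof.
pose proof (proj1 HM k); pose proof (pow_lt b k b_pos); repeat apply Rmult_le_pos; lra.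
Qed.

Lemma bang_mean_value n k x0 delta y :
  (k <= n)%nat -> Rabs x0 + delta < r -> delta * (4 * b) <= bang_step M n ->
  Cmod (d k x0) * 2 ^ S n <= A * b ^ k * M k * 2 ^ k ->
  (forall z, Rabs (z - x0) <= delta ->
     Cmod (d (S k) z) * 2 ^ n <= A * b ^ S k * M (S k) * 2 ^ S k) ->
  Rabs (y - x0) <= delta -> Cmod (d k y) * 2 ^ n <= A * b ^ k * M k * 2 ^ k.
Proof.
intros k_le ball_in delta_le d_x0_le dS_le y_near.
pose proof (pow_lt 2 n ltac:(lra)) as pow2_pos; pose proof (INR_S_pos k).
set (D := A * b ^ S k * M (S k) * 2 ^ S k / 2 ^ n) in *.
assert (variation : Cmod (d k y - d k x0) <= INR (S k) * D * Rabs (y - x0)).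
{ apply (Cmod_variation_le (d k) (fun z => INR (S k) * d (S k) z)%C); intros z z_near; split.
  - apply d_derive; pose proof (Rabs_triang_inv z x0); lra.
  - rewrite Cmod_mult, Cmod_R, Rabs_pos_eq by lra; apply Rmult_le_compat_l; [lra|].
    apply Rmult_le_reg_r with (2 ^ n); [easy|].
    replace (D * 2 ^ n) with (A * b ^ S k * M (S k) * 2 ^ S k) by (unfold D; field; lra).
    apply dS_le; lra. }
assert (delta_ge : 0 <= delta) by (pose proof (Rabs_pos (y - x0)); lra).
assert (slope_le : INR (S k) * D * delta * 2 ^ n <= A * b ^ k * 2 ^ k / 2 * M k).
{ replace (INR (S k) * D * delta * 2 ^ n) with
    (A * b ^ k * 2 ^ k / 2 * (INR (S k) * M (S k) * (delta * (4 * b))))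
    by (unfold D; simpl pow; field; lra).
  pose proof (pow_lt b k b_pos); pose proof (pow_lt 2 k ltac:(lra)).
  apply Rmult_le_compat_l; [repeat apply Rmult_le_pos; lra|].
  eapply Rle_trans; [|now apply (bang_step_le M k n)].
  apply Rmult_le_compat_l; [pose proof (proj1 HM (S k)); nra|easy]. }
apply Rle_trans with ((Cmod (d k x0) + INR (S k) * D * delta) * 2 ^ n).
- apply Rmult_le_compat_r; [lra|].
  replace (d k y) with (d k x0 + (d k y - d k x0))%C by ring.
  eapply Rle_trans; [apply Cmod_triangle|]; apply Rplus_le_compat_l.
  eapply Rle_trans; [exact variation|]; apply Rmult_le_compat_l; [|easy].
  apply Rmult_le_pos; [lra|].
  apply Rmult_le_pos; [|left; now apply Rinv_0_lt_compat].
  apply Rmult_le_pos; [apply majorant_pos|apply pow_le; lra].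
- simpl pow in d_x0_le; lra.
Qed.

(* Bang's argument: moving by a multiple of [bang_step M n] at most doubles the ratio of
   the jet to its a priori bound. *)
Lemma bang_level_drop n x0 delta y : Rabs x0 + delta < r -> delta * (4 * b) <= bang_step M n ->
  bang_level (S n) x0 -> Rabs (y - x0) <= delta -> bang_level n y.
Proof.
intros ball_in delta_le level0 y_near k.
assert (large_k : forall k z, (n <= k)%nat -> Rabs z < r ->
  Cmod (d k z) * 2 ^ n <= A * b ^ k * M k * 2 ^ k).
{ clear k; intros k z k_ge z_lt.
  apply Rmult_le_compat; [apply Cmod_ge_0|apply pow_le; lra|now apply d_le|].
  apply Rle_pow; [lra|easy]. }
assert (descent : forall i k z, (n <= k + i)%nat -> Rabs (z - x0) <= delta ->
  Cmod (d k z) * 2 ^ n <= A * b ^ k * M k * 2 ^ k).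
{ clear k; induction i as [|i IH]; intros k z k_ge z_near.
  - apply large_k; [lia|]; pose proof (Rabs_triang_inv z x0); lra.
  - destruct (Nat.le_gt_cases n k) as [n_le|k_lt].
    + apply large_k; [easy|]; pose proof (Rabs_triang_inv z x0); lra.
    + apply (bang_mean_value n k x0 delta); try easy; [lia|].
      intros w w_near; apply IH; [lia|easy]. }
apply (descent n); [lia|easy].
Qed.

Hypothesis d_0 : forall k, d k 0 = 0%C.

Lemma bang_level_of_sum j : forall n x, Rabs x < r ->
  Rabs x * (4 * b) <= sum_f_R0 (fun i => bang_step M (n + i)) j -> bang_level n x.
Proof.
induction j as [|j IH]; intros n x x_lt x_le.
- apply (bang_level_drop n 0 (Rabs x)); rewrite ?Rabs_R0, ?Rminus_0_r; try lra.
  + simpl in x_le; now rewrite Nat.add_0_r in x_le.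
  + intros k; rewrite d_0, Cmod_0, Rmult_0_l.
    apply Rmult_le_pos; [apply majorant_pos|apply pow_le; lra].
- rewrite decomp_sum, Nat.add_0_r in x_le by lia; simpl pred in x_le.
  rewrite (sum_eq _ (fun i => bang_step M (S n + i))) in x_le
    by (intros i _; f_equal; lia).
  pose proof (bang_step_pos M n HM) as step_pos.
  set (step := bang_step M n) in *; set (rest := sum_f_R0 _ j) in *.
  assert (rest_pos : 0 < rest) by (apply tech1; intros; now apply bang_step_pos).
  set (theta := rest / (step + rest)).
  assert (theta_eq : theta * (step + rest) = rest) by (unfold theta; field; lra).
  assert (theta_in : 0 <= theta <= 1) by nra.
  pose proof (Rabs_pos x) as x_pos.
  apply (bang_level_drop n (theta * x) ((1 - theta) * Rabs x));
    rewrite ?Rabs_mult, ?(Rabs_pos_eq theta) by lra.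
  + lra.
  + fold step; apply Rle_trans with ((1 - theta) * (step + rest)); [|lra].
    rewrite Rmult_assoc; apply Rmult_le_compat_l; lra.
  + apply IH; rewrite Rabs_mult, (Rabs_pos_eq theta) by lra; [nra|].
    fold rest; rewrite <- theta_eq, Rmult_assoc; apply Rmult_le_compat_l; lra.
  + replace (x - theta * x) with ((1 - theta) * x) by ring.
    rewrite Rabs_mult, (Rabs_pos_eq (1 - theta)); lra.
Qed.

End Bang.

Lemma CM_within_jet M r f : CM_within M r f -> exists A b d, 0 <= A /\ 1 <= b /\ jet r f d /\
  forall k x, Rabs x < r -> Cmod (d k x) <= A * b ^ k * damped M k.
Proof.
intros (A & b & A_ge & b_ge & bound); destruct (bound 0%nat) as (d & jet_d & _).
exists A, b, d; do 3 (split; [easy|]); intros k x x_lt.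
destruct (bound k) as (e & jet_e & e_le).
rewrite (jet_unique r f d e) by easy; now apply e_le.
Qed.

Theorem denjoy_carleman M r f : DC_weight M -> unbounded_sums (bang_step M) ->
  CM_within M r f -> flat_germ f -> forall x, Rabs x < r -> f x = 0%C.
Proof.
intros HM diverges Hf f_flat x x_lt; pose proof (DC_weight_log_convex M HM) as HM'.
destruct (CM_within_jet M r f Hf) as (A & b & d & A_ge & b_ge & jet_d & d_le).
assert (r_pos : 0 < r) by (pose proof (Rabs_pos x); lra).
assert (d_le' : forall k y, Rabs y < r -> Cmod (d k y) <= A * b ^ k * M k).
{ intros k y y_lt; eapply Rle_trans; [now apply d_le|]; pose proof (pow_lt b k ltac:(lra)).
  apply Rmult_le_compat_l; [apply Rmult_le_pos; lra|now apply damped_le]. }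
assert (d_0 : forall k, d k 0 = 0%C).
{ intros k; destruct (f_flat (S k)) as (g & Hg & fg).
  now apply (jet_0_of_div_pow (S k) r f d g); try lia. }
assert (level : forall n, Cmod (f x) * 2 ^ n <= A).
{ intros n; destruct (unbounded_sums_tail _ n diverges (Rabs x * (4 * b))) as [N sum_gt].
  pose proof (bang_level_of_sum M r A b d HM' A_ge ltac:(lra) (proj2 jet_d) d_le' d_0
    N n x x_lt ltac:(lra) 0%nat) as level.
  rewrite (proj1 jet_d) in level by easy; rewrite (proj1 HM) in level; simpl in level; lra. }
apply Cmod_eq_0, NNPP; intros fx_neq; pose proof (Cmod_ge_0 (f x)).
destruct (Pow_x_infinity 2 ltac:(rewrite Rabs_pos_eq; lra) (A / Cmod (f x) + 1)) as (n & pow_ge).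
specialize (pow_ge n (le_n n)); specialize (level n).
rewrite Rabs_pos_eq in pow_ge by (apply pow_le; lra).
assert (A_eq : A / Cmod (f x) * Cmod (f x) = A) by (field; lra).
nra.
Qed.

Corollary CM_germ_flat_eq_0 M f : DC_weight M -> unbounded_sums (bang_step M) ->
  CM_germ M f -> flat_germ f -> locally 0 (fun t => f t = 0%C).
Proof.
intros HM diverges Hf f_flat; destruct (at_right_0_ex _ Hf) as (r & r_pos & Hf_r).
generalize (locally_Rabs_lt 0 r ltac:(now rewrite Rabs_R0)); apply filter_imp.
now apply (denjoy_carleman M r f).
Qed.

(** * Carleman's inequality *)

Lemma ln_le_sub_1 x : 0 < x -> ln x <= x - 1.
Proof.
intros x_pos; pose proof (exp_ineq1_le (ln x)) as exp_ge; rewrite exp_ln in exp_ge by easy; lra.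
Qed.

Lemma exp_le_exp x y : x <= y -> exp x <= exp y.
Proof. intros [x_lt| ->]; [left; now apply exp_increasing|lra]. Qed.

Lemma ln_fact_ge n : INR n * ln (INR n) - INR n <= ln (INR (fact n)).
Proof.
induction n as [|[|n] IH]; [simpl; rewrite ln_1; lra|simpl; rewrite ln_1; lra|].
rewrite INR_fact_S, ln_mult by (apply INR_S_pos || apply INR_fact_lt_0).
pose proof (INR_S_pos n); rewrite (S_INR (S n)); set (x := INR (S n)) in *.
assert (ln_incr : ln (x + 1) - ln x <= / x).
{ rewrite <- ln_div by lra; eapply Rle_trans; [apply ln_le_sub_1, Rdiv_lt_0_compat; lra|].
  right; field; lra. }
assert (x * (ln (x + 1) - ln x) <= 1).
{ apply Rle_trans with (x * / x); [apply Rmult_le_compat_l; lra|right; field; lra]. }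
lra.
Qed.

Definition mean (a : nat -> R) (n : nat) : R := sum_f_R0 a n / INR (S n).

Lemma mean_pos a n : (forall j, 0 < a j) -> 0 < mean a n.
Proof. intros pos; apply Rdiv_lt_0_compat; [apply tech1; auto|apply INR_S_pos]. Qed.

Lemma sum_ln_le_ln_mean a n : (forall j, 0 < a j) ->
  sum_f_R0 (fun j => ln (a j)) n <= INR (S n) * ln (mean a n).
Proof.
intros pos; pose proof (mean_pos a n pos) as mean_gt; pose proof (INR_S_pos n).
apply Rle_trans with (sum_f_R0 (fun j => a j * / mean a n + (ln (mean a n) - 1)) n).
- apply sum_Rle; intros j _.
  pose proof (ln_le_sub_1 (a j / mean a n) ltac:(now apply Rdiv_lt_0_compat)) as ln_le.
  rewrite ln_div in ln_le by auto; unfold Rdiv in ln_le; lra.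
- rewrite sum_plus, sum_cte, <- scal_sum.
  replace (sum_f_R0 a n) with (mean a n * INR (S n)) by (unfold mean; field; lra).
  right; field; lra.
Qed.

(* The term [- mean a n] makes the induction work. *)
Lemma sum_mean_le a n : (forall j, 0 < a j) ->
  sum_f_R0 (fun i => mean a i / INR (S i)) n <=
  2 * sum_f_R0 (fun j => a j / INR (S j)) n - mean a n.
Proof.
intros pos; induction n as [|n IH].
{ unfold mean; simpl; pose proof (pos 0%nat); lra. }
rewrite !tech5; pose proof (mean_pos a n pos); pose proof (pos (S n)).
enough (mean a (S n) / INR (S (S n)) <=
        2 * (a (S n) / INR (S (S n))) + mean a n - mean a (S n)) by lra.
unfold mean in *; rewrite tech5, (S_INR (S n)); pose proof (INR_S_ge_1 n).
set (x := INR (S n)) in *; set (s := sum_f_R0 a n) in *; set (c := a (S n)) in *.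
assert (s_pos : 0 < s) by (apply tech1; auto).
apply Rmult_le_reg_r with (x * (x + 1) ^ 2); [nra|].
replace ((s + c) / (x + 1) / (x + 1) * (x * (x + 1) ^ 2)) with (x * (s + c)) by (field; lra).
replace ((2 * (c / (x + 1)) + s / x - (s + c) / (x + 1)) * (x * (x + 1) ^ 2)) with
  (s * (x + 1) + c * x * (x + 1)) by (field; lra).
nra.
Qed.

Lemma ln_eq_sum_ln_ratio M n : (forall k, 0 < M k) -> M 0%nat = 1 ->
  ln (M (S n)) = - sum_f_R0 (fun j => ln (M j / M (S j))) n.
Proof.
intros pos M0; induction n as [|n IH]; simpl.
- rewrite ln_div, M0, ln_1 by apply pos; ring.
- rewrite (ln_div (M (S n))) by apply pos; rewrite Ropp_plus_distr, <- IH; ring.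
Qed.

Lemma Rpower_fact_le_mean M n : (forall k, 0 < M k) -> M 0%nat = 1 ->
  Rpower (INR (fact (S n)) * M (S n)) (- / INR (S n)) <=
  3 * (mean (fun j => M j / M (S j)) n / INR (S n)).
Proof.
intros pos M0; set (ratio := fun j => M j / M (S j)).
assert (ratio_pos : forall j, 0 < ratio j) by (intros; apply Rdiv_lt_0_compat; apply pos).
pose proof (sum_ln_le_ln_mean ratio n ratio_pos) as AM_GM.
pose proof (mean_pos ratio n ratio_pos) as mean_gt.
pose proof (ln_fact_ge (S n)) as Stirling; pose proof (INR_S_pos n).
unfold Rpower; rewrite ln_mult by (apply pos || apply INR_fact_lt_0).
rewrite ln_eq_sum_ln_ratio by easy.
change (sum_f_R0 _ n) with (sum_f_R0 (fun j => ln (ratio j)) n).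
apply Rle_trans with (exp (1 + (ln (mean ratio n) + - ln (INR (S n))))).
- apply exp_le_exp; apply Rmult_le_reg_l with (INR (S n)); [easy|].
  rewrite <- Rmult_assoc, Ropp_mult_distr_r_reverse, Rinv_r by lra; lra.
- rewrite exp_plus, exp_plus, exp_Ropp, !exp_ln by easy.
  apply Rmult_le_compat_r; [|apply exp_le_3].
  left; now apply Rdiv_lt_0_compat.
Qed.

Lemma quasianalytic_unbounded_sums M : DC_weight M -> quasianalytic M ->
  unbounded_sums (bang_step M).
Proof.
intros HM diverges B; destruct (diverges (6 * B)) as [N sum_gt]; exists N.
pose proof HM as (M0 & pos & _); set (ratio := fun j => M j / M (S j)).
assert (ratio_pos : forall j, 0 < ratio j) by (intros; apply Rdiv_lt_0_compat; apply pos).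
assert (sum_le : sum_f_R0 (fun i => Rpower (INR (fact (S i)) * M (S i)) (- / INR (S i))) N
  <= sum_f_R0 (fun i => mean ratio i / INR (S i) * 3) N).
{ apply sum_Rle; intros i _; rewrite (Rmult_comm _ 3); now apply Rpower_fact_le_mean. }
rewrite <- scal_sum in sum_le.
pose proof (sum_mean_le ratio N ratio_pos); pose proof (mean_pos ratio N ratio_pos).
rewrite (sum_eq (bang_step M) (fun j => ratio j / INR (S j))); [lra|].
intros i _; unfold ratio, bang_step; pose proof (pos (S i)); pose proof (INR_S_pos i).
field; lra.
Qed.

(** * Polynomial differential equations *)

Lemma filter_forall_In {T I : Type} (F : (T -> Prop) -> Prop) {FF : Filter F}
    (l : list I) (P : I -> T -> Prop) :
  (forall i, In i l -> F (P i)) -> F (fun x => forall i, In i l -> P i x).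
Proof.
induction l as [|i l IH]; intros F_P; [apply filter_forall; easy|].
pose proof (F_P i (or_introl eq_refl)) as F_Pi.
pose proof (IH (fun j j_in => F_P j (or_intror j_in))) as F_Pl.
generalize (filter_and _ _ F_Pi F_Pl); apply filter_imp.
intros x [Pi Pl] j [<-|j_in]; auto.
Qed.

Inductive generated_algebra (P : (R -> C) -> Prop) (ys : list (R -> C)) : (R -> C) -> Prop :=
| generated_base f : P f -> generated_algebra P ys f
| generated_unknown y : In y ys -> generated_algebra P ys y
| generated_plus f g : generated_algebra P ys f -> generated_algebra P ys g ->
    generated_algebra P ys (fun x => f x + g x)%C
| generated_mult f g : generated_algebra P ys f -> generated_algebra P ys g ->
    generated_algebra P ys (fun x => f x * g x)%C.

Lemma function_algebra_generated P ys : function_algebra P ->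
  function_algebra (generated_algebra P ys).
Proof.
intros HP; split; [|apply generated_plus|apply generated_mult].
intros c; now apply generated_base, algebra_const.
Qed.

Section PolynomialODE.

Variables (M : nat -> R) (r : R) (ys : list (R -> C)).
Hypothesis HM : DC_weight M.

Let alg : (R -> C) -> Prop := generated_algebra (CM_within M r) ys.

Hypothesis ode : forall y, In y ys ->
  exists phi, alg phi /\ forall x, Rabs x < r -> is_derive y x (phi x).

Lemma ode_algebra_derive f : alg f ->
  exists f', alg f' /\ forall x, Rabs x < r -> is_derive f x (f' x).
Proof.
induction 1 as [f Hf|y y_in|f g _ (f' & Hf' & df) _ (g' & Hg' & dg)
               |f g Hf (f' & Hf' & df) Hg (g' & Hg' & dg)].
- destruct (CM_within_derive M r f HM Hf) as (f' & Hf' & df).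
  exists f'; split; [now apply generated_base|easy].
- now apply ode.
- exists (fun x => f' x + g' x)%C; split; [now apply generated_plus|].
  intros x x_lt; exact (is_derive_plus _ _ _ _ _ (df x x_lt) (dg x x_lt)).
- exists (fun x => f' x * g x + f x * g' x)%C; split.
  + now apply generated_plus; apply generated_mult.
  + intros x x_lt; now apply is_derive_Cmult; [apply df|apply dg].
Qed.

Lemma ode_algebra_bound a f : 0 <= a -> alg f ->
  exists A, 0 <= A /\ Rbar_locally p_infty (fun b => forall n,
    (forall y, In y ys -> jet_bound M r n a b y) -> jet_bound M r n A b f).
Proof.
intros a_ge; induction 1 as [f (A & b & A_ge & b_ge & f_le)|y y_in
  |f g _ (A & A_ge & f_le) _ (A' & A'_ge & g_le)|f g _ (A & A_ge & f_le) _ (A' & A'_ge & g_le)].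
- exists A; split; [easy|]; exists b; intros b' b'_gt n _.
  apply (jet_bound_incr M r n A b); try easy; lra.
- exists a; split; [easy|]; exists 0; intros b _ n ys_le; auto.
- exists (A + A'); split; [lra|].
  generalize (filter_and _ _ f_le g_le); apply filter_imp; intros b [f_le_b g_le_b] n ys_le.
  apply jet_bound_plus; auto.
- exists (8 * A * A'); split; [nra|].
  assert (b_ge : Rbar_locally p_infty (fun b => 1 <= b)) by (exists 1; intros; lra).
  generalize (filter_and _ _ b_ge (filter_and _ _ f_le g_le)); apply filter_imp.
  intros b (b_ge_1 & f_le_b & g_le_b) n ys_le; apply jet_bound_mult; auto.
Qed.

Theorem CM_within_ode a : (forall y x, In y ys -> Rabs x < r -> Cmod (y x) <= a) ->
  forall y, In y ys -> CM_within M r y.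
Proof.
intros ys_le y y_in.
set (a' := Rmax 1 a); assert (a'_ge : 1 <= a') by apply Rmax_l.
assert (ys_le' : forall y x, In y ys -> Rabs x < r -> Cmod (y x) <= a').
{ intros z x z_in x_lt; eapply Rle_trans; [now apply ys_le|apply Rmax_r]. }
assert (succ_bound : Rbar_locally p_infty (fun b => forall z, In z ys -> forall n,
    (forall y, In y ys -> jet_bound M r n a' b y) -> jet_bound M r (S n) a' b z)).
{ apply filter_forall_In; [apply Rbar_locally_filter|]; intros z z_in.
  destruct (ode z z_in) as (phi & Hphi & dz).
  destruct (ode_algebra_bound a' phi ltac:(lra) Hphi) as (A & A_ge & phi_le).
  assert (b_ge : Rbar_locally p_infty (fun b => Rmax 1 (4 * A) < b))
    by now exists (Rmax 1 (4 * A)).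
  generalize (filter_and _ _ b_ge phi_le); apply filter_imp; intros b [b_gt phi_le_b] n bound_n.
  pose proof (Rmax_l 1 (4 * A)); pose proof (Rmax_r 1 (4 * A)).
  apply (jet_bound_primitive M r n A b a' z phi); auto; nra. }
assert (b_ge : Rbar_locally p_infty (fun b => 1 <= b)) by (exists 1; intros; lra).
destruct (filter_ex _ (filter_and _ _ b_ge succ_bound)) as (b & b_ge_1 & succ_b).
exists a', b; split; [lra|split; [easy|]]; intros n.
revert y y_in; induction n as [|n IH]; intros y y_in; [|now apply succ_b].
destruct (smooth_within_of_derive_closed r alg ode_algebra_derive y) as [d jet_d];
  [now apply generated_unknown|].
exists d; split; [easy|]; intros k x k_le x_lt; replace k with 0%nat by lia.
rewrite (proj1 jet_d), damped_0, !Rmult_1_r by easy; auto.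
Qed.

End PolynomialODE.

(** * Polynomials with function coefficients *)

Inductive fpoly : Type :=
| FConst : (R -> C) -> fpoly
| FX : fpoly
| FAdd : fpoly -> fpoly -> fpoly
| FMul : fpoly -> fpoly -> fpoly.

Fixpoint feval (p : fpoly) (t : R) (z : C) : C :=
  match p with
  | FConst a => a t
  | FX => z
  | FAdd p q => (feval p t z + feval q t z)%C
  | FMul p q => (feval p t z * feval q t z)%C
  end.

Definition feval_along (p : fpoly) (h : R -> C) (t : R) : C := feval p t (h t).

Fixpoint coefs_in (P : (R -> C) -> Prop) (p : fpoly) : Prop :=
  match p with
  | FConst a => P a
  | FX => True
  | FAdd p q => coefs_in P p /\ coefs_in P q
  | FMul p q => coefs_in P p /\ coefs_in P q
  end.

Fixpoint fderiv (p : fpoly) : fpoly :=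
  match p with
  | FConst _ => FConst (fun _ => 0%C)
  | FX => FConst (fun _ => 1%C)
  | FAdd p q => FAdd (fderiv p) (fderiv q)
  | FMul p q => FAdd (FMul (fderiv p) q) (FMul p (fderiv q))
  end.

Lemma coefs_in_imp (P Q : (R -> C) -> Prop) p :
  (forall f, P f -> Q f) -> coefs_in P p -> coefs_in Q p.
Proof. intros PQ; induction p; simpl; [apply PQ|easy|tauto|tauto]. Qed.

Lemma coefs_in_at_right (P : R -> (R -> C) -> Prop) p :
  coefs_in (fun f => at_right 0 (fun r => P r f)) p -> at_right 0 (fun r => coefs_in (P r) p).
Proof.
induction p as [a| |p IHp q IHq|p IHp q IHq]; simpl; [easy| | |].
- intros _; now apply filter_forall.
- intros [Hp Hq]; apply filter_and; auto.
- intros [Hp Hq]; apply filter_and; auto.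
Qed.

Lemma coefs_in_fderiv P p : function_algebra P -> coefs_in P p -> coefs_in P (fderiv p).
Proof.
intros HP; induction p; simpl; intros Hp; solve [now apply algebra_const|tauto].
Qed.

Lemma coefs_in_iter_fderiv P e p : function_algebra P ->
  coefs_in P p -> coefs_in P (Nat.iter e fderiv p).
Proof. intros HP Hp; induction e as [|e IH]; [easy|now apply coefs_in_fderiv]. Qed.

Lemma algebra_feval_along P p h : function_algebra P -> coefs_in P p -> P h ->
  P (feval_along p h).
Proof.
intros HP Hp Hh; unfold feval_along.
induction p as [a| |p IHp q IHq|p IHp q IHq]; simpl in *; [easy|easy| |].
- apply (algebra_plus P HP (fun t => feval p t (h t)) (fun t => feval q t (h t))); tauto.
- apply (algebra_mult P HP (fun t => feval p t (h t)) (fun t => feval q t (h t))); tauto.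
Qed.

Lemma is_derive_feval p t (z : C) :
  is_derive (V := AbsRing_NormedModule C_AbsRing) (feval p t) z (feval (fderiv p) t z).
Proof.
induction p as [a| |p IHp q IHq|p IHp q IHq]; simpl.
- apply (is_derive_const (V := AbsRing_NormedModule C_AbsRing)).
- apply (is_derive_id z).
- exact (is_derive_plus _ _ _ _ _ IHp IHq).
- exact (is_derive_mult (K := C_AbsRing) _ _ _ _ _ IHp IHq Cmult_comm).
Qed.

(* Coquelicot has two normed spaces on C over C, which differ in their uniform structure. *)
Lemma is_derive_C_NormedModule (f : C -> C) z (l : C) :
  is_derive (V := AbsRing_NormedModule C_AbsRing) f z l ->
  is_derive (V := C_NormedModule) f z l.
Proof.
intros [_ df]; split; [apply is_linear_scal_l|].
intros x x_lim eps; exact (df x x_lim eps).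
Qed.

Lemma feval_fderiv_ext p q t : (forall z, feval p t z = feval q t z) ->
  forall z, feval (fderiv p) t z = feval (fderiv q) t z.
Proof.
intros pq z.
transitivity (C_derive (feval q t) z); [symmetry|];
  apply is_C_derive_unique, is_derive_C_NormedModule.
- eapply is_derive_ext; [exact pq|apply is_derive_feval].
- apply is_derive_feval.
Qed.

Lemma is_derive_feval_along (P : (R -> C) -> Prop) r p : function_algebra P ->
  (forall f, P f -> exists f', P f' /\ forall x, Rabs x < r -> is_derive f x (f' x)) ->
  coefs_in P p -> exists q, coefs_in P q /\
    forall (h : R -> C) t (l : C), Rabs t < r -> is_derive h t l ->
    is_derive (feval_along p h) t (feval q t (h t) + feval (fderiv p) t (h t) * l)%C.
Proof.
intros HP closed; unfold feval_along.
induction p as [a| |p IHp q IHq|p IHp q IHq]; simpl; intros Hp.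
- destruct (closed a Hp) as (a' & Ha' & da).
  exists (FConst a'); split; [easy|]; intros h t l t_lt _; simpl.
  replace (a' t + 0 * l)%C with (a' t) by ring; auto.
- exists (FConst (fun _ => 0%C)); split; [now apply algebra_const|].
  intros h t l _ dh; simpl; replace (0 + 1 * l)%C with l by ring; exact dh.
- destruct Hp as [Hp Hq].
  destruct (IHp Hp) as (p' & Hp' & dp); destruct (IHq Hq) as (q' & Hq' & dq).
  exists (FAdd p' q'); split; [easy|]; intros h t l t_lt dh; simpl.
  replace (feval p' t (h t) + feval q' t (h t)
           + (feval (fderiv p) t (h t) + feval (fderiv q) t (h t)) * l)%C with
    ((feval p' t (h t) + feval (fderiv p) t (h t) * l)
     + (feval q' t (h t) + feval (fderiv q) t (h t) * l))%C by ring.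
  exact (is_derive_plus _ _ _ _ _ (dp h t l t_lt dh) (dq h t l t_lt dh)).
- destruct Hp as [Hp Hq].
  destruct (IHp Hp) as (p' & Hp' & dp); destruct (IHq Hq) as (q' & Hq' & dq).
  exists (FAdd (FMul p' q) (FMul p q')); split; [easy|]; intros h t l t_lt dh; simpl.
  replace (feval p' t (h t) * feval q t (h t) + feval p t (h t) * feval q' t (h t)
           + (feval (fderiv p) t (h t) * feval q t (h t)
              + feval p t (h t) * feval (fderiv q) t (h t)) * l)%C with
    ((feval p' t (h t) + feval (fderiv p) t (h t) * l) * feval q t (h t)
     + feval p t (h t) * (feval q' t (h t) + feval (fderiv q) t (h t) * l))%C by ring.
  exact (is_derive_Cmult _ _ _ _ _ (dp h t l t_lt dh) (dq h t l t_lt dh)).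
Qed.

(** * The implicit function theorem *)

Lemma implicit_derive r G Gt (h : R -> C) t (l : C) :
  (forall x, Rabs x < r -> feval G x (h x) = 0%C) -> Rabs t < r ->
  feval (fderiv G) t (h t) <> 0%C ->
  is_derive (feval_along G h) t (feval Gt t (h t) + feval (fderiv G) t (h t) * l)%C ->
  l = (-1 * (feval Gt t (h t) * / feval (fderiv G) t (h t)))%C.
Proof.
intros root t_lt simple dG.
assert (dzero : is_derive (feval_along G h) t (RtoC 0)).
{ apply (is_derive_ext_ball r (fun _ => RtoC 0)); [|easy|].
  - intros x x_lt; symmetry; now apply root.
  - apply (is_derive_const (V := C_R_NormedModule)). }
apply (is_derive_C_unique _ _ _ _ dzero) in dG.
apply (Cmult_eq_reg_l (feval (fderiv G) t (h t))); [easy|].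
transitivity (0 - feval Gt t (h t))%C; [rewrite dG; ring|field; easy].
Qed.

(* The root [h] and the inverse of dG/dz along [h] solve a polynomial differential system. *)
Lemma CM_within_implicit M r G (h h' : R -> C) a : DC_weight M -> coefs_in (CM_within M r) G ->
  (forall t, Rabs t < r -> is_derive h t (h' t)) ->
  (forall t, Rabs t < r -> feval G t (h t) = 0%C) ->
  (forall t, Rabs t < r -> feval (fderiv G) t (h t) <> 0%C) ->
  (forall t, Rabs t < r -> Cmod (h t) <= a /\ Cmod (/ feval (fderiv G) t (h t)) <= a) ->
  CM_within M r h.
Proof.
intros HM HG dh root simple bounded.
pose proof (function_algebra_CM_within M r HM) as CM_alg.
pose proof (fun f => CM_within_derive M r f HM) as closed.
pose proof (coefs_in_fderiv _ _ CM_alg HG) as HG'.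
destruct (is_derive_feval_along _ r G CM_alg closed HG) as (Gt & HGt & dG).
destruct (is_derive_feval_along _ r _ CM_alg closed HG') as (G't & HG't & dG').
set (v := fun t => (/ feval_along (fderiv G) h t)%C).
set (alg := generated_algebra (CM_within M r) (h :: v :: nil)).
assert (alg_algebra : function_algebra alg) by now apply function_algebra_generated.
assert (alg_along : forall p, coefs_in (CM_within M r) p -> alg (feval_along p h)).
{ intros p Hp; apply algebra_feval_along; [easy| |apply generated_unknown; now left].
  revert Hp; apply coefs_in_imp; apply generated_base. }
assert (alg_v : alg v) by (apply generated_unknown; right; now left).
set (phi := fun t => (-1 * (feval_along Gt h t * v t))%C).
assert (alg_phi : alg phi).
{ apply (generated_mult _ _ (fun _ => (-1)%C)); [now apply algebra_const|].
  now apply generated_mult; [apply alg_along|]. }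
assert (h'_eq : forall t, Rabs t < r -> h' t = phi t).
{ intros t t_lt; apply (implicit_derive r G Gt h); auto. }
set (psi := fun t => (-1 * (v t * v t) *
   (feval_along G't h t + feval_along (fderiv (fderiv G)) h t * phi t))%C).
assert (alg_psi : alg psi).
{ apply (generated_mult _ _ (fun t => -1 * (v t * v t))%C).
  - apply (generated_mult _ _ (fun _ => (-1)%C)); [now apply algebra_const|].
    now apply generated_mult.
  - apply generated_plus; [now apply alg_along|].
    apply generated_mult; [|easy]; now apply alg_along, coefs_in_fderiv. }
apply (CM_within_ode M r (h :: v :: nil) HM) with (a := a); [| |now left].
- intros y [<-|[<-|[]]]; [exists phi|exists psi]; split; try easy; intros t t_lt.
  + rewrite <- h'_eq by easy; auto.
  + unfold psi; rewrite <- h'_eq by easy.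
    replace (-1 * (v t * v t))%C with (- (v t * v t))%C by ring.
    apply (is_derive_Cinv (feval_along (fderiv G) h)); [now apply simple|].
    apply dG'; auto.
- intros y t [<-|[<-|[]]] t_lt; now apply bounded.
Qed.

Theorem CM_germ_implicit M G h : DC_weight M -> coefs_in (CM_germ M) G -> smooth_germ h ->
  locally 0 (fun t => feval G t (h t) = 0%C) -> feval (fderiv G) 0 (h 0) <> 0%C ->
  CM_germ M h.
Proof.
intros HM HG Hh root simple.
pose proof function_algebra_smooth_germ as smooth_alg.
assert (Hw : smooth_germ (feval_along (fderiv G) h)).
{ apply algebra_feval_along; try easy; apply coefs_in_fderiv; [easy|].
  revert HG; apply coefs_in_imp; intros f; apply CM_germ_smooth. }
apply smooth_germ_continuous in Hw as w_cont.
pose proof (continuous_neq_0_locally _ 0 w_cont simple) as w_neq.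
pose proof (continuous_Cmod_bounded_below _ 0 w_cont simple) as w_below.
pose proof (continuous_Cmod_bounded h 0 (smooth_germ_continuous h Hh)) as h_bounded.
pose proof (filter_and _ _ root (filter_and _ _ w_neq (filter_and _ _ w_below h_bounded)))
  as near.
apply locally_0_iff in near; apply coefs_in_at_right in HG.
destruct (at_right_0_ex _ (filter_and _ _ Hh (filter_and _ _ HG near)))
  as (r & r_pos & [d jet_d] & HG_r & near_r).
apply (CM_germ_of_within M r); [easy|].
set (a := Rmax (Cmod (h 0) + 1) (/ (Cmod (feval_along (fderiv G) h 0) / 2))).
apply (CM_within_implicit M r G h (d 1%nat) a); try easy.
- intros t t_lt; now apply (jet_is_derive r).
- intros t t_lt; now apply near_r.
- intros t t_lt; now apply near_r.
- intros t t_lt; destruct (near_r t t_lt) as (_ & wt_neq & wt_below & ht_le); split.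
  + eapply Rle_trans; [exact ht_le|apply Rmax_l].
  + rewrite Cmod_inv by easy; eapply Rle_trans; [|apply Rmax_r].
    apply Rinv_le_contravar; [|easy]; apply Cmod_gt_0 in simple; unfold feval_along; lra.
Qed.

(** * Roots of polynomials with Denjoy-Carleman coefficients *)

(* The quadratic remainder of [p (T + s X)], see [feval_taylor]. *)
Fixpoint taylor_remainder (p : fpoly) (T s : R -> C) : fpoly :=
  match p with
  | FConst _ => FConst (fun _ => 0%C)
  | FX => FConst (fun _ => 0%C)
  | FAdd p q => FAdd (taylor_remainder p T s) (taylor_remainder q T s)
  | FMul p q =>
      let p0 := FConst (feval_along p T) in let p1 := FConst (feval_along (fderiv p) T) in
      let q0 := FConst (feval_along q T) in let q1 := FConst (feval_along (fderiv q) T) in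
      let sX := FMul (FConst s) FX in
      let p2 := taylor_remainder p T s in let q2 := taylor_remainder q T s in
      FAdd (FMul p1 q1)
        (FAdd (FMul p2 (FAdd q0 (FAdd (FMul sX q1) (FMul (FMul sX sX) q2))))
              (FMul (FAdd p0 (FMul sX p1)) q2))
  end.

Lemma feval_taylor p T s t w :
  feval p t (T t + s t * w)%C =
  (feval p t (T t) + s t * w * feval (fderiv p) t (T t)
   + (s t * w) * (s t * w) * feval (taylor_remainder p T s) t w)%C.
Proof.
induction p as [a| |p IHp q IHq|p IHp q IHq]; simpl; [ring|ring| |]; rewrite IHp, IHq;
  unfold feval_along; ring.
Qed.

Lemma coefs_in_taylor_remainder P p T s : function_algebra P -> coefs_in P p -> P T -> P s ->
  coefs_in P (taylor_remainder p T s).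
Proof.
intros HP Hp HT Hs; induction p as [a| |p IHp q IHq|p IHp q IHq]; simpl in *;
  [now apply algebra_const|now apply algebra_const|tauto|].
destruct Hp as [Hp Hq]; specialize (IHp Hp); specialize (IHq Hq).
pose proof (algebra_feval_along P p T HP Hp HT); pose proof (algebra_feval_along P q T HP Hq HT).
pose proof (algebra_feval_along P _ T HP (coefs_in_fderiv P p HP Hp) HT).
pose proof (algebra_feval_along P _ T HP (coefs_in_fderiv P q HP Hq) HT).
tauto.
Qed.

Lemma fderiv_along_truncation Q f T h u0 k : coefs_in smooth_germ Q ->
  smooth_germ f -> smooth_germ h -> h 0 = 0%C -> smooth_germ u0 -> u0 0 <> 0%C ->
  locally 0 (fun t => f t = T t + RtoC t ^ k * h t)%C ->
  locally 0 (fun t => feval (fderiv Q) t (f t) = RtoC t ^ k * u0 t)%C ->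
  exists u, smooth_germ u /\ u 0 <> 0%C /\
    locally 0 (fun t => feval (fderiv Q) t (T t) = RtoC t ^ k * u t)%C.
Proof.
intros HQ Hf Hh h0 Hu0 u0_neq f_eq Q'f_eq.
pose proof function_algebra_smooth_germ as alg.
pose proof (coefs_in_fderiv _ Q alg HQ) as HQ'; pose proof (coefs_in_fderiv _ _ alg HQ') as HQ''.
pose (s := fun t => (RtoC t ^ k)%C); pose (oh := fun t => (-1 * h t)%C).
assert (Hs : smooth_germ s) by (apply algebra_pow; [easy|apply smooth_germ_RtoC]).
assert (Hoh : smooth_germ oh)
  by (apply (algebra_mult _ alg (fun _ => (-1)%C)); [now apply algebra_const|easy]).
pose (U := FAdd (FConst u0) (FAdd (FMul FX (FConst (feval_along (fderiv (fderiv Q)) f)))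
  (FMul (FConst s) (FMul FX (FMul FX (taylor_remainder (fderiv Q) f s)))))).
exists (feval_along U oh); split; [|split].
- apply algebra_feval_along; try easy; simpl; repeat split; try easy.
  + now apply algebra_feval_along.
  + now apply coefs_in_taylor_remainder.
- unfold feval_along, U, oh; simpl; rewrite h0.
  intros U_0; apply u0_neq; rewrite <- U_0; ring.
- generalize (filter_and _ _ f_eq Q'f_eq); apply filter_imp; intros t [ft_eq Q'ft_eq].
  replace (T t) with (f t + s t * oh t)%C by (rewrite ft_eq; unfold s, oh; ring).
  rewrite feval_taylor, Q'ft_eq; unfold feval_along, U; simpl; unfold feval_along, s; ring.
Qed.

Lemma feval_along_truncation Q f T h u k : coefs_in smooth_germ Q ->
  smooth_germ T -> smooth_germ h -> smooth_germ u ->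
  locally 0 (fun t => f t = T t + RtoC t ^ k * h t)%C ->
  locally 0 (fun t => feval Q t (f t) = 0%C) ->
  locally 0 (fun t => feval (fderiv Q) t (T t) = RtoC t ^ k * u t)%C ->
  exists b, smooth_germ b /\
    locally 0 (fun t => feval Q t (T t) = RtoC t ^ (k + k) * b t)%C /\
    forall t, feval (FAdd (FConst b) (FAdd (FMul FX (FConst u)) (FMul FX (FMul FX
      (taylor_remainder Q T (fun t => RtoC t ^ k)%C))))) t (h t) = 0%C.
Proof.
intros HQ HT Hh Hu f_eq root Q'T_eq.
pose proof function_algebra_smooth_germ as alg.
pose (s := fun t => (RtoC t ^ k)%C); fold s.
assert (Hs : smooth_germ s) by (apply algebra_pow; [easy|apply smooth_germ_RtoC]).
pose (B := FMul (FConst (fun _ => (-1)%C)) (FAdd (FMul FX (FConst u))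
  (FMul FX (FMul FX (taylor_remainder Q T s))))).
exists (feval_along B h); split; [|split].
- apply algebra_feval_along; try easy; simpl; repeat split; try easy.
  + now apply algebra_const.
  + now apply coefs_in_taylor_remainder.
- generalize (filter_and _ _ f_eq (filter_and _ _ root Q'T_eq)); apply filter_imp.
  intros t (ft_eq & roott & Q'Tt_eq); fold (s t) in *.
  rewrite ft_eq, feval_taylor, Q'Tt_eq in roott.
  rewrite Cpow_add_r; fold (s t).
  rewrite <- (Cplus_0_r (s t * s t * feval_along B h t)), <- roott.
  unfold feval_along, B; simpl; ring.
- intros t; unfold B, feval_along; simpl; unfold feval_along; ring.
Qed.

(* Newton's method in the form of Tougeron's implicit function theorem: if dQ/dz has
   order k along f, the substitution z = T + t^k h, with T a Taylor polynomial of f,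
   turns Q = 0 into an equation with invertible linear part for h. *)
Theorem CM_germ_simple_root M Q f : DC_weight M -> coefs_in (CM_germ M) Q -> smooth_germ f ->
  locally 0 (fun t => feval Q t (f t) = 0%C) -> finite_order (feval_along (fderiv Q) f) ->
  CM_germ M f.
Proof.
intros HM HQ Hf root (k & u0 & Hu0 & u0_neq & Q'f_eq).
pose proof (function_algebra_CM_germ M HM) as CM_alg.
pose proof function_algebra_smooth_germ as smooth_alg.
assert (HQs : coefs_in smooth_germ Q)
  by (revert HQ; apply coefs_in_imp; intros g; apply CM_germ_smooth).
destruct (smooth_germ_taylor M f (S k) HM Hf) as (T & g & HT & Hg & fT).
pose (h := fun t => (RtoC t * g t)%C).
assert (Hh : smooth_germ h)
  by (apply (algebra_mult _ smooth_alg RtoC); [apply smooth_germ_RtoC|easy]).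
assert (h0 : h 0 = 0%C) by (unfold h; ring).
assert (f_eq : locally 0 (fun t => f t = T t + RtoC t ^ k * h t)%C).
{ generalize fT; apply filter_imp; intros t ->; unfold h; simpl; ring. }
assert (HTs : smooth_germ T) by now apply (CM_germ_smooth M).
assert (Hs : CM_germ M (fun t => RtoC t ^ k)%C) by now apply algebra_pow, CM_germ_RtoC.
destruct (fderiv_along_truncation Q f T h u0 k) as (u & Hu & u_neq & Q'T_eq); try easy.
destruct (feval_along_truncation Q f T h u k) as (b & Hb & QT_eq & h_root); try easy.
assert (Hu_CM : CM_germ M u).
{ apply (CM_germ_div_pow M (feval_along (fderiv Q) T) u k); try easy.
  now apply algebra_feval_along; [|apply coefs_in_fderiv|]. }
assert (Hb_CM : CM_germ M b).
{ apply (CM_germ_div_pow M (feval_along Q T) b (k + k)); try easy.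
  now apply algebra_feval_along. }
assert (Hh_CM : CM_germ M h).
{ eapply (CM_germ_implicit M _ h HM); [|easy|apply filter_forall; exact h_root|].
  - simpl; repeat split; try easy; now apply coefs_in_taylor_remainder.
  - simpl; rewrite h0.
    intros derivative_0; apply u_neq; rewrite <- derivative_0; ring. }
apply (CM_germ_ext_loc M (fun t => T t + RtoC t ^ k * h t)%C).
- generalize f_eq; apply filter_imp; now intros t ->.
- apply algebra_plus; [easy|easy|]; now apply algebra_mult.
Qed.

Fixpoint fmul_root_pow (a : C) (e : nat) (q : fpoly) : fpoly :=
  match e with
  | O => q
  | S e => FMul (FAdd FX (FConst (fun _ => - a)%C)) (fmul_root_pow a e q)
  end.

Lemma feval_fmul_root_pow a e q t z :
  feval (fmul_root_pow a e q) t z = ((z - a) ^ e * feval q t z)%C.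
Proof. induction e as [|e IH]; simpl; [ring|rewrite IH; ring]. Qed.

Lemma feval_fderiv_fmul_root_pow a e q t z :
  feval (fderiv (fmul_root_pow a (S e) q)) t z =
  ((z - a) ^ e * (INR (S e) * feval q t z + (z - a) * feval (fderiv q) t z))%C.
Proof.
induction e as [|e IH]; [simpl; ring|].
change (fmul_root_pow a (S (S e)) q) with
  (FMul (FAdd FX (FConst (fun _ => - a)%C)) (fmul_root_pow a (S e) q)).
cbn [fderiv feval]; rewrite IH, feval_fmul_root_pow, (S_INR (S e)), RtoC_plus; simpl Cpow; ring.
Qed.

Lemma feval_iter_fderiv_root e : forall p q t a,
  (forall z, feval p t z = (z - a) ^ S e * feval q t z)%C ->
  feval (Nat.iter e fderiv p) t a = 0%C /\
  feval (Nat.iter (S e) fderiv p) t a = (INR (fact (S e)) * feval q t a)%C.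
Proof.
assert (fderiv_eq : forall e p q t a, (forall z, feval p t z = (z - a) ^ S e * feval q t z)%C ->
  forall z, feval (fderiv p) t z =
    ((z - a) ^ e * (INR (S e) * feval q t z + (z - a) * feval (fderiv q) t z))%C).
{ intros e' p q t a p_eq z; rewrite <- feval_fderiv_fmul_root_pow.
  apply feval_fderiv_ext; intros w; now rewrite p_eq, feval_fmul_root_pow. }
induction e as [|e IH]; intros p q t a p_eq.
- split; simpl; [rewrite p_eq|rewrite (fderiv_eq 0%nat p q t a p_eq)]; simpl; ring.
- destruct (IH (fderiv p) (FAdd (FMul (FConst (fun _ => RtoC (INR (S (S e))))) q)
      (FMul (FAdd FX (FConst (fun _ => - a)%C)) (fderiv q))) t a) as [value derivative].
  { intros z; rewrite (fderiv_eq (S e) p q t a p_eq z); reflexivity. }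
  rewrite (Nat.iter_succ_r (S e) _ fderiv), derivative, (Nat.iter_succ_r e _ fderiv).
  split; [exact value|].
  rewrite (INR_fact_S (S e)), RtoC_mult; cbn [feval]; ring.
Qed.

Fixpoint root_product (s : list C) (z : C) : C :=
  match s with nil => 1%C | a :: s => ((z - a) * root_product s z)%C end.

Lemma root_product_root s z : In z s -> root_product s z = 0%C.
Proof.
induction s as [|a s IH]; simpl; [easy|]; intros [->|z_in]; [ring|].
rewrite IH by easy; ring.
Qed.

Lemma root_product_split f fs :
  (forall g, In g fs -> locally 0 (fun t => g t = f t) \/ finite_order (fun t => f t - g t)%C) ->
  exists e q, finite_order (feval_along q f) /\
    locally 0 (fun t => forall z,
      root_product (map (fun g => g t) fs) z = (z - f t) ^ e * feval q t z)%C.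
Proof.
induction fs as [|g fs IH]; intros dichotomy.
- exists 0%nat, (FConst (fun _ => 1%C)); split.
  + exists 0%nat, (fun _ => 1%C); split; [apply (algebra_const _ function_algebra_smooth_germ)|].
    split; [apply C1_nz|apply filter_forall; intros t; unfold feval_along; simpl; ring].
  + apply filter_forall; intros t z; simpl; ring.
- destruct IH as (e & q & q_order & product_eq); [intros g' g'_in; apply dichotomy; now right|].
  destruct (dichotomy g (or_introl eq_refl)) as [gf|diff_order].
  + exists (S e), q; split; [easy|].
    generalize (filter_and _ _ gf product_eq); apply filter_imp; intros t [gt_eq eq_t] z.
    simpl; rewrite gt_eq, eq_t; ring.
  + exists e, (FMul (FAdd FX (FConst (fun t => - g t)%C)) q); split.
    * exact (finite_order_mult _ _ diff_order q_order).
    * generalize product_eq; apply filter_imp; intros t eq_t z; simpl; rewrite eq_t; ring.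
Qed.

Fixpoint fmonic (l : list (R -> C)) : fpoly :=
  match l with
  | nil => FConst (fun _ => 1%C)
  | a :: l => FAdd (FConst a) (FMul FX (fmonic l))
  end.

Lemma coefs_in_fmonic P l : function_algebra P -> Forall P l -> coefs_in P (fmonic l).
Proof. intros HP; induction 1; simpl; [now apply algebra_const|easy]. Qed.

Lemma flat_root_eq_0 M l w : DC_weight M -> unbounded_sums (bang_step M) ->
  Forall (CM_germ M) l -> smooth_germ w -> flat_germ w ->
  locally 0 (fun t => feval (fmonic l) t (w t) = 0%C -> w t = 0%C).
Proof.
intros HM diverges Hl Hw w_flat; induction Hl as [|a l Ha Hl IH].
- apply filter_forall; intros t E; now apply C1_nz in E.
- destruct (finite_order_or_flat a (CM_germ_smooth M a Ha)) as [a_order|a_flat].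
  + assert (value_order : finite_order (feval_along (fmonic (a :: l)) w)).
    { apply (finite_order_plus_flat a (fun t => w t * feval (fmonic l) t (w t))%C); [easy|].
      apply (flat_germ_mult w (feval_along (fmonic l) w)); [easy|].
      apply algebra_feval_along; [apply function_algebra_smooth_germ| |easy].
      apply coefs_in_fmonic; [apply function_algebra_smooth_germ|].
      revert Hl; apply Forall_impl; intros g; apply CM_germ_smooth. }
    generalize (finite_order_neq_0 _ value_order); apply (filter_imp (F := locally 0)).
    intros t value_neq value_0; destruct (Req_dec t 0) as [->|t_neq]; [now apply flat_germ_0|].
    now destruct (value_neq t_neq).
  + pose proof (CM_germ_flat_eq_0 M a HM diverges Ha a_flat) as a_0.
    generalize (filter_and _ _ a_0 IH); apply filter_imp; simpl; intros t [-> IH_t] value_0.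
    apply NNPP; intros wt_neq; apply wt_neq, IH_t, (Cmult_eq_reg_l (w t)); [easy|].
    rewrite Cplus_0_l in value_0; rewrite value_0; ring.
Qed.

Lemma eq_or_finite_order_difference M l f g : DC_weight M -> unbounded_sums (bang_step M) ->
  Forall (CM_germ M) l -> smooth_germ f -> smooth_germ g ->
  locally 0 (fun t => feval (fmonic l) t (f t - g t) = 0)%C ->
  locally 0 (fun t => g t = f t) \/ finite_order (fun t => f t - g t)%C.
Proof.
intros HM diverges Hl Hf Hg root; pose proof function_algebra_smooth_germ as alg.
assert (Hw : smooth_germ (fun t => f t - g t)%C).
{ apply (smooth_germ_ext_loc (fun t => f t + -1 * g t)%C).
  - apply filter_forall; intros t; ring.
  - apply (algebra_plus _ alg f); [easy|].
    apply (algebra_mult _ alg (fun _ => (-1)%C)); [now apply algebra_const|easy]. }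
destruct (finite_order_or_flat _ Hw) as [|w_flat]; [now right|left].
pose proof (flat_root_eq_0 M l _ HM diverges Hl Hw w_flat) as w_0.
generalize (filter_and _ _ root w_0); apply filter_imp; intros t [roott w_0t].
replace (f t) with (f t - g t + g t)%C by ring; rewrite w_0t by easy; ring.
Qed.

Theorem smooth_root_CM_germ M l f fs : DC_weight M -> unbounded_sums (bang_step M) ->
  Forall (CM_germ M) l -> (forall g, In g fs -> smooth_germ g) -> In f fs ->
  locally 0 (fun t => forall z,
    feval (fmonic l) t z = root_product (map (fun g => g t) fs) z) ->
  (forall g, In g fs -> exists l', Forall (CM_germ M) l' /\
     locally 0 (fun t => feval (fmonic l') t (f t - g t) = 0)%C) ->
  CM_germ M f.
Proof.
intros HM diverges Hl Hfs f_in product_eq differences.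
destruct (root_product_split f fs) as (e & q & (k & u & Hu & u_neq & q_eq) & split_eq).
{ intros g g_in; destruct (differences g g_in) as (l' & Hl' & root').
  apply (eq_or_finite_order_difference M l'); auto. }
pose proof (filter_and _ _ product_eq split_eq) as fmonic_eq.
pose proof function_algebra_smooth_germ as smooth_alg.
pose proof (function_algebra_CM_germ M HM) as CM_alg.
destruct e as [|e].
{ exfalso.
  assert (q_order : finite_order (feval_along q f)) by now exists k, u.
  apply (filter_not_empty (F := Rbar_locally' 0)).
  generalize (filter_and (F := locally 0) _ _ fmonic_eq (finite_order_neq_0 _ q_order)).
  apply (filter_imp (F := locally 0)); intros t [[_ split_t] qt_neq] t_neq.
  apply (qt_neq t_neq); unfold feval_along; specialize (split_t (f t)).
  rewrite root_product_root in split_t by now apply (in_map (fun g => g t)).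
  simpl in split_t; now rewrite Cmult_1_l in split_t. }
apply (CM_germ_simple_root M (Nat.iter e fderiv (fmonic l))); auto.
- apply coefs_in_iter_fderiv, coefs_in_fmonic; auto.
- generalize fmonic_eq; apply filter_imp; intros t [product_t split_t].
  apply (feval_iter_fderiv_root e (fmonic l) q); intros z; now rewrite product_t, split_t.
- exists k, (fun t => INR (fact (S e)) * u t)%C; split; [|split].
  + apply (algebra_mult _ smooth_alg (fun _ => RtoC (INR (fact (S e))))); [|easy].
    now apply algebra_const.
  + apply Cmult_neq_0; [apply RtoC_neq_0, INR_fact_neq_0|easy].
  + generalize (filter_and _ _ q_eq fmonic_eq); apply filter_imp.
    intros t (qt_eq & product_t & split_t); unfold feval_along in *.
    change (fderiv (Nat.iter e fderiv (fmonic l))) with (Nat.iter (S e) fderiv (fmonic l)).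
    rewrite (proj2 (feval_iter_fderiv_root e (fmonic l) q t (f t)
      ltac:(intros z; now rewrite product_t, split_t))), qt_eq; ring.
Qed.

(** * Smooth and Denjoy-Carleman maps on intervals *)

Lemma sym_interval_iff r t : sym_interval r t <-> Rabs t < r.
Proof.
unfold sym_interval; split; [intros [t_gt t_lt]; apply Rabs_def1; lra|].
intros t_lt; apply Rabs_def2 in t_lt; lra.
Qed.

Lemma derivs_on_jet r (f : R -> C) D1 D2 :
  derivs_on (sym_interval r) (fun t => fst (f t)) D1 ->
  derivs_on (sym_interval r) (fun t => snd (f t)) D2 ->
  jet r f (fun k t => / INR (fact k) * (D1 k t, D2 k t))%C.
Proof.
intros [D1_0 D1_S] [D2_0 D2_S]; split.
- intros t t_lt; apply sym_interval_iff in t_lt; rewrite D1_0, D2_0 by easy.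
  rewrite <- surjective_pairing; simpl; field; apply C1_nz.
- intros k t t_lt; apply sym_interval_iff in t_lt.
  replace (INR (S k) * (/ INR (fact (S k)) * (D1 (S k) t, D2 (S k) t)))%C with
    (/ INR (fact k) * (D1 (S k) t, D2 (S k) t))%C.
  + apply is_derive_Cscal, is_derive_C_iff; split; apply is_derive_Reals;
      [now apply D1_S|now apply D2_S].
  + rewrite INR_fact_S, RtoC_mult.
    field; split; [apply RtoC_neq_0, INR_fact_neq_0|apply RtoC_INR_S_neq_0].
Qed.

Lemma smooth_germ_of_Cinf_on r (f : R -> C) : 0 < r ->
  Cinf_on (sym_interval r) (fun t => fst (f t)) ->
  Cinf_on (sym_interval r) (fun t => snd (f t)) -> smooth_germ f.
Proof.
intros r_pos [D1 HD1] [D2 HD2]; apply (smooth_germ_of_within r); [easy|].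
eexists; exact (derivs_on_jet r f D1 D2 HD1 HD2).
Qed.

Lemma CM_on_bound M r f : 0 < r -> CM_on M (sym_interval r) f ->
  exists D A b, derivs_on (sym_interval r) f D /\ 0 < A /\ 0 < b /\
    forall k t, Rabs t < r / 2 -> Rabs (D k t) <= A * b ^ k * INR (fact k) * M k.
Proof.
intros r_pos (D & HD & D_le).
destruct (D_le (fun t => - (r / 2) <= t <= r / 2)) as (A & b & A_pos & b_pos & bound).
- intros t t_in; unfold sym_interval; lra.
- apply compact_P3.
- exists D, A, b; do 3 (split; [easy|]); intros k t t_lt.
  apply Rabs_def2 in t_lt; apply bound; lra.
Qed.

Lemma CM_germ_of_CM_on M r (f : R -> C) : DC_weight M -> 0 < r ->
  CM_on M (sym_interval r) (fun t => fst (f t)) ->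
  CM_on M (sym_interval r) (fun t => snd (f t)) -> CM_germ M f.
Proof.
intros HM r_pos re_CM im_CM; apply (CM_germ_of_within M (r / 2)); [lra|].
destruct (CM_on_bound M r _ r_pos re_CM) as (D1 & A1 & b1 & HD1 & A1_pos & b1_pos & bound1).
destruct (CM_on_bound M r _ r_pos im_CM) as (D2 & A2 & b2 & HD2 & A2_pos & b2_pos & bound2).
set (b := 1 + b1 + b2); exists (A1 + A2), (4 * b).
split; [lra|split; [unfold b; lra|]]; intros n.
exists (fun k t => / INR (fact k) * (D1 k t, D2 k t))%C; split.
{ apply (jet_restrict r); [lra|now apply derivs_on_jet]. }
intros k t _ t_lt; specialize (bound1 k t t_lt); specialize (bound2 k t t_lt).
pose proof (INR_fact_lt_0 k) as fact_pos; pose proof (DC_weight_pos M k HM) as M_pos.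
assert (pow_le_b : forall A c, 0 < A -> 0 < c <= b ->
  A * c ^ k * INR (fact k) * M k <= A * b ^ k * INR (fact k) * M k).
{ intros A c A_pos c_le; repeat (apply Rmult_le_compat_r; [lra|]).
  apply Rmult_le_compat_l; [lra|]; apply pow_incr; lra. }
pose proof (pow_le_b A1 b1 A1_pos ltac:(unfold b; lra)).
pose proof (pow_le_b A2 b2 A2_pos ltac:(unfold b; lra)).
rewrite Cmod_mult, Cmod_inv, Cmod_R, Rabs_pos_eq
  by (apply RtoC_neq_0, INR_fact_neq_0 || lra).
apply Rmult_le_reg_l with (INR (fact k)); [easy|].
rewrite <- Rmult_assoc, Rinv_r, Rmult_1_l by lra.
eapply Rle_trans; [apply Cmod_le_add_Rabs|cbn [fst snd]].
apply Rle_trans with (INR (fact k) * ((A1 + A2) * b ^ k * M k)); [lra|].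
apply Rmult_le_compat_l; [lra|]; rewrite Rpow_mult_distr.
replace ((A1 + A2) * (4 ^ k * b ^ k) * damped M k) with
  ((A1 + A2) * b ^ k * (4 ^ k * damped M k)) by ring.
apply Rmult_le_compat_l; [|now apply le_damped].
apply Rmult_le_pos; [lra|apply pow_le; unfold b; lra].
Qed.

Lemma CM_within_CM_on M r (f : R -> C) (part : C -> R) : DC_weight M ->
  (forall z, Rabs (part z) <= Cmod z) -> (forall (a : R) z, part (a * z)%C = a * part z) ->
  (forall (g : R -> C) t (l : C), is_derive g t l ->
     is_derive (fun s => part (g s)) t (part l)) ->
  CM_within M r f -> CM_on M (sym_interval r) (fun t => part (f t)).
Proof.
intros HM part_le part_scal part_derive Hf.
destruct (CM_within_jet M r f Hf) as (A & b & d & A_ge & b_ge & [d0 dS] & d_le).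
exists (fun k t => INR (fact k) * part (d k t)); split; [split|].
- intros t t_in; apply sym_interval_iff in t_in; rewrite d0 by easy; simpl; ring.
- intros k t t_in; apply sym_interval_iff in t_in; apply is_derive_Reals.
  replace (INR (fact (S k)) * part (d (S k) t)) with
    (INR (fact k) * part (INR (S k) * d (S k) t)%C) by (rewrite part_scal, INR_fact_S; ring).
  apply (is_derive_scal (fun s => part (d k s))); auto.
- intros K K_in _; exists (A + 1), b; split; [lra|split; [lra|]]; intros k t t_in.
  apply K_in, sym_interval_iff in t_in; specialize (d_le k t t_in); specialize (part_le (d k t)).
  pose proof (INR_fact_lt_0 k); pose proof (damped_le M k HM); pose proof (damped_pos M k HM).
  pose proof (pow_lt b k ltac:(lra)) as pow_pos.
  rewrite Rabs_mult, (Rabs_pos_eq (INR _)) by lra.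
  replace ((A + 1) * b ^ k * INR (fact k) * M k) with (INR (fact k) * ((A + 1) * b ^ k * M k))
    by ring.
  apply Rmult_le_compat_l; [lra|].
  apply Rle_trans with (A * b ^ k * damped M k); [lra|].
  apply Rmult_le_compat; try lra; apply Rmult_le_pos; lra.
Qed.

Lemma CM_within_CM_on_re M r (f : R -> C) : DC_weight M -> CM_within M r f ->
  CM_on M (sym_interval r) (fun t => fst (f t)).
Proof.
intros HM; apply CM_within_CM_on; [easy|apply Rabs_fst_le_Cmod|intros; simpl; ring|].
now intros g t l dg; apply is_derive_C_iff in dg.
Qed.

Lemma CM_within_CM_on_im M r (f : R -> C) : DC_weight M -> CM_within M r f ->
  CM_on M (sym_interval r) (fun t => snd (f t)).
Proof.
intros HM; apply CM_within_CM_on; [easy|apply Rabs_snd_le_Cmod|intros; simpl; ring|].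
now intros g t l dg; apply is_derive_C_iff in dg.
Qed.

(** * Coefficients of a product of linear factors *)

Section RootCoefs.

Variables (A : Type) (sub_mul : A -> A -> A -> A) (zero one : A).

(* With [sub_mul c a b] read as c - a b, the list [mul_linear a c l] contains the
   coefficients of c + (X - a) p for the monic polynomial p with lower coefficients l. *)
Fixpoint mul_linear (a c : A) (l : list A) : list A :=
  match l with
  | nil => sub_mul c a one :: nil
  | b :: l => sub_mul c a b :: mul_linear a b l
  end.

Definition root_coefs (s : list A) : list A := fold_right (fun a => mul_linear a zero) nil s.

Lemma Forall_root_coefs (P : A -> Prop) s :
  (forall c a b, P c -> P a -> P b -> P (sub_mul c a b)) -> P zero -> P one ->
  Forall P s -> Forall P (root_coefs s).
Proof.
intros P_sub_mul P0 P1; induction 1 as [|a s Pa _ IH]; simpl; [easy|].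
assert (P_mul_linear : forall l c, P c -> Forall P l -> Forall P (mul_linear a c l)).
{ induction l as [|b l IHl]; intros c Pc Pl; simpl; [auto|].
  inversion Pl; subst; auto. }
auto.
Qed.

End RootCoefs.

Lemma map_root_coefs {A B : Type} (phi : A -> B) sub_mul zero one sub_mul' zero' one' s :
  (forall c a b, phi (sub_mul c a b) = sub_mul' (phi c) (phi a) (phi b)) ->
  phi zero = zero' -> phi one = one' ->
  map phi (root_coefs A sub_mul zero one s) = root_coefs B sub_mul' zero' one' (map phi s).
Proof.
intros phi_sub_mul phi0 phi1; induction s as [|a s IH]; simpl; [easy|].
rewrite <- IH, <- phi0; generalize (root_coefs A sub_mul zero one s) as l; intros l.
generalize zero; induction l as [|b l IHl]; intros c; simpl; rewrite phi_sub_mul;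
  [now rewrite phi1|now rewrite IHl].
Qed.

Definition C_root_coefs : list C -> list C := root_coefs C (fun c a b => c - a * b)%C 0%C 1%C.

Fixpoint monic_value (l : list C) (z : C) : C :=
  match l with nil => 1%C | c :: l => (c + z * monic_value l z)%C end.

Lemma feval_fmonic l t z : feval (fmonic l) t z = monic_value (map (fun g => g t) l) z.
Proof. induction l as [|g l IH]; simpl; [easy|now rewrite IH]. Qed.

Lemma monic_value_C_root_coefs s z : monic_value (C_root_coefs s) z = root_product s z.
Proof.
assert (mul_linear_value : forall l a c,
  monic_value (mul_linear C (fun c a b => c - a * b)%C 1%C a c l) z
  = (c + (z - a) * monic_value l z)%C).
{ induction l as [|b l IH]; intros a c; simpl; [ring|rewrite IH; ring]. }
induction s as [|a s IH]; simpl; [easy|].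
rewrite mul_linear_value; fold (C_root_coefs s); rewrite IH; ring.
Qed.

Lemma C_root_coefs_permutation s s' : Permutation s s' -> C_root_coefs s = C_root_coefs s'.
Proof.
pose (mul a c l := mul_linear C (fun c a b => c - a * b)%C 1%C a c l).
assert (mul_swap : forall l a b c c' e, (c - a * e = c' - b * e)%C ->
  mul a c (mul b e l) = mul b c' (mul a e l)).
{ unfold mul; induction l as [|x l IH]; intros a b c c' e E; simpl.
  - f_equal; [|f_equal; ring].
    replace (c - a * (e - b * 1))%C with (c - a * e + a * b)%C by ring; rewrite E; ring.
  - f_equal; [|apply IH; ring].
    replace (c - a * (e - b * x))%C with (c - a * e + a * b * x)%C by ring; rewrite E; ring. }
induction 1 as [|a s s' _ IH|a b s|s s' s'' _ IH1 _ IH2]; simpl.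
- easy.
- fold (C_root_coefs s); fold (C_root_coefs s'); now rewrite IH.
- apply mul_swap; ring.
- congruence.
Qed.

(** * Polynomial maps *)

Lemma algebra_peval P n (x : R -> nat -> Cplx) p : function_algebra P -> pvars_lt n p ->
  (forall j, is_true (ssrnat.leq (S j) n) -> P (fun t => x t j)) ->
  P (fun t => peval (x t) p).
Proof.
intros HP Hp Hx; induction p as [c|i|p IHp q IHq|p IHp q IHq]; simpl in *.
- now apply (algebra_const P HP c).
- now apply Hx.
- apply (algebra_plus P HP (fun t => peval (x t) p) (fun t => peval (x t) q)); tauto.
- apply (algebra_mult P HP (fun t => peval (x t) p) (fun t => peval (x t) q)); tauto.
Qed.

Lemma peval_ext n x y p : pvars_lt n p ->
  (forall i, is_true (ssrnat.leq (S i) n) -> x i = y i) -> peval x p = peval y p.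
Proof. intros Hp xy; induction p; simpl in *; auto; destruct Hp; f_equal; auto. Qed.

Fixpoint psubst (s : nat -> cpoly) (p : cpoly) : cpoly :=
  match p with
  | PC c => PC c
  | PX i => s i
  | PAdd p q => PAdd (psubst s p) (psubst s q)
  | PMul p q => PMul (psubst s p) (psubst s q)
  end.

Lemma peval_psubst x s p : peval x (psubst s p) = peval (fun i => peval x (s i)) p.
Proof. induction p; simpl; congruence. Qed.

Lemma pvars_lt_psubst n s p : (forall i, pvars_lt n (s i)) -> pvars_lt n (psubst s p).
Proof. intros Hs; induction p; simpl; auto. Qed.

Fixpoint linear_form (a : nat -> Cplx) (n : nat) : cpoly :=
  match n with
  | O => PC C0
  | S n => PAdd (linear_form a n) (PMul (PC (a n)) (PX n))
  end.

Lemma peval_linear_form x a n : peval x (linear_form a n) = Csum n (fun j => Cmul (a j) (x j)).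
Proof. induction n as [|n IH]; simpl; [easy|now rewrite IH]. Qed.

Definition psub_mul (c a b : cpoly) : cpoly := PAdd c (PMul (PC (RtoC (-1))) (PMul a b)).

Definition cpoly_root_coefs : list cpoly -> list cpoly :=
  root_coefs cpoly psub_mul (PC (RtoC 0)) (PC (RtoC 1)).

Lemma peval_cpoly_root_coefs x s :
  map (peval x) (cpoly_root_coefs s) = C_root_coefs (map (peval x) s).
Proof.
apply map_root_coefs; [|easy|easy]; intros c a b; simpl.
change (peval x c + -1 * (peval x a * peval x b) = peval x c - peval x a * peval x b)%C; ring.
Qed.

Lemma pvars_lt_cpoly_root_coefs n s :
  Forall (pvars_lt n) s -> Forall (pvars_lt n) (cpoly_root_coefs s).
Proof. now apply Forall_root_coefs. Qed.

(** * Orbits of a finite group *)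

From mathcomp Require Import all_boot all_fingroup.
From Stdlib Require Import Rdefinitions.
Local Close Scope R_scope.

Lemma In_mem (T : eqType) (s : seq T) x : In x s <-> x \in s.
Proof.
elim: s => [|a s IH] /=; first by [].
rewrite in_cons; split.
- by case=> [->|/IH ->]; rewrite ?eqxx ?orbT.
- by case/orP=> [/eqP ->|/IH]; [left|right].
Qed.

Lemma uniq_NoDup (T : eqType) (s : seq T) : uniq s -> NoDup s.
Proof.
elim: s => [|a s IH] /=; first by constructor.
case/andP=> a_notin s_uniq; constructor; last exact: IH.
by move/In_mem; apply/negP.
Qed.

Lemma enum_mulg_permutation (gT : finGroupType) (g : gT) :
  Permutation (List.map (fun h => (h * g)%g) (enum gT)) (enum gT).
Proof.
have enum_NoDup : NoDup (enum gT) by apply: uniq_NoDup; exact: enum_uniq.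
have In_enum h : In h (enum gT) by apply/In_mem; rewrite mem_enum.
apply: NoDup_Permutation => //.
- by apply: FinFun.Injective_map_NoDup => // h h'; apply: mulIg.
- move=> h; split=> // _; apply/in_map_iff.
  by exists (h * g^-1)%g; rewrite mulgKV.
Qed.

Lemma pvars_lt_linear_form d a m : (m <= d)%N -> pvars_lt d (linear_form a m).
Proof. by elim: m => //= m IH m_lt; split=> //; apply: IH; exact: ltnW. Qed.

Section Orbit.

Variables (gT : finGroupType) (d : nat) (rho : gT -> nat -> nat -> Cplx).
Hypothesis rho_action : linear_action d rho.

Definition translate (p : cpoly) (g : gT) : cpoly :=
  psubst (fun i => linear_form (rho g i) d) p.

Lemma peval_translate p g x : peval x (translate p g) = peval (Defs.act d rho g x) p.
Proof.
rewrite /translate peval_psubst; congr (peval _ p).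
by apply: functional_extensionality => i; rewrite peval_linear_form.
Qed.

Lemma pvars_lt_translate p g : pvars_lt d (translate p g).
Proof. by apply: pvars_lt_psubst => i; apply: pvars_lt_linear_form. Qed.

Definition orbit_coefs (p : cpoly) : list cpoly :=
  cpoly_root_coefs (List.map (translate p) (enum gT)).

Lemma peval_orbit_coefs p x : List.map (peval x) (orbit_coefs p) =
  C_root_coefs (List.map (fun g => peval (Defs.act d rho g x) p) (enum gT)).
Proof.
rewrite peval_cpoly_root_coefs List.map_map; congr C_root_coefs.
by apply: map_ext => g; apply: peval_translate.
Qed.

Lemma orbit_coefs_invariant p q :
  pvars_lt d p -> In q (orbit_coefs p) -> Defs.invariant d rho q.
Proof.
move=> Hp q_in; split.
- move: q q_in; apply/Forall_forall; apply: pvars_lt_cpoly_root_coefs.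
  by apply/Forall_map/Forall_forall => g _; apply: pvars_lt_translate.
- move=> g x; move: q q_in; apply: ext_in_map; rewrite !peval_orbit_coefs.
  transitivity (C_root_coefs (List.map (fun h => peval (Defs.act d rho h x) p)
    (List.map (fun h => (h * g)%g) (enum gT)))); last first.
    by apply: C_root_coefs_permutation; apply: Permutation_map; apply: enum_mulg_permutation.
  rewrite (List.map_map (fun h => (h * g)%g)); congr C_root_coefs; apply: map_ext => h.
  by apply: (peval_ext d) => // i i_lt; rewrite rho_action.2.
Qed.

Variables (n : nat) (sigma : nat -> cpoly) (M : nat -> R) (c cbar : R -> nat -> Cplx).
Hypothesis HM : DC_weight M.
Hypothesis diverges : unbounded_sums (bang_step M).
Hypothesis sigma_basis : hilbert_basis d rho n sigma.
Hypothesis Hc : forall j, (j < n)%N -> CM_germ M (fun t => c t j).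
Hypothesis Hcbar : forall i, (i < d)%N -> smooth_germ (fun t => cbar t i).
Hypothesis lift :
  locally 0%R (fun t => forall j, (j < n)%N -> peval (cbar t) (sigma j) = c t j).

Lemma CM_germ_invariant_along p :
  Defs.invariant d rho p -> CM_germ M (fun t => peval (cbar t) p).
Proof.
move=> p_inv; have [_ sigma_generates] := sigma_basis.
have [q [Hq p_eq]] := sigma_generates p p_inv.
apply: (CM_germ_ext_loc M (fun t => peval (c t) q)).
- move: lift; apply: filter_imp => t lift_t; rewrite p_eq.
  by apply: (peval_ext n) => // j j_lt; rewrite lift_t.
- by apply: (algebra_peval _ n) => //; apply: function_algebra_CM_germ.
Qed.

Definition orbit_along (p : cpoly) : list (R -> C) :=
  List.map (fun g t => peval (Defs.act d rho g (cbar t)) p) (enum gT).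

Lemma orbit_along_at p t : List.map (fun f => f t) (orbit_along p) =
  List.map (fun g => peval (Defs.act d rho g (cbar t)) p) (enum gT).
Proof. exact: List.map_map. Qed.

Lemma orbit_along_fmonic p : pvars_lt d p -> exists l, Forall (CM_germ M) l /\
  forall t z, feval (fmonic l) t z = root_product (List.map (fun g => g t) (orbit_along p)) z.
Proof.
move=> Hp; exists (List.map (fun q t => peval (cbar t) q) (orbit_coefs p)); split.
- apply/Forall_map/Forall_forall => q q_in.
  exact: CM_germ_invariant_along (orbit_coefs_invariant p q Hp q_in).
- move=> t z; rewrite feval_fmonic orbit_along_at -monic_value_C_root_coefs.
  by rewrite -peval_orbit_coefs; congr (monic_value _ z); apply: List.map_map.
Qed.

Lemma orbit_along_smooth p f : In f (orbit_along p) -> smooth_germ f.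
Proof.
move=> /in_map_iff [g [<- _]].
apply: (smooth_germ_ext_loc (fun t => peval (cbar t) (translate p g))).
- by apply: filter_forall => t; apply: peval_translate.
- apply: (algebra_peval _ d) => //; first exact: function_algebra_smooth_germ.
  exact: pvars_lt_translate.
Qed.

Lemma orbit_along_self p : pvars_lt d p -> In (fun t => peval (cbar t) p) (orbit_along p).
Proof.
move=> Hp; apply/in_map_iff; exists 1%g; split; last by apply/In_mem; rewrite mem_enum.
apply: functional_extensionality => t.
by apply: (peval_ext d) => // i i_lt; apply: rho_action.1.
Qed.

(* The difference of [p] and its translate by [g] is itself a polynomial function, so it is
   a root of a monic polynomial over C^M by the same argument. *)
Theorem CM_germ_polynomial_along p : pvars_lt d p -> CM_germ M (fun t => peval (cbar t) p).
Proof.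
move=> Hp; have [l [Hl product_eq]] := orbit_along_fmonic p Hp.
apply: (smooth_root_CM_germ M l _ (orbit_along p)) => //.
- by move=> f; apply: orbit_along_smooth.
- exact: orbit_along_self.
- exact: filter_forall.
- move=> _ /in_map_iff [g [<- _]].
  pose q := psub_mul p (PC (RtoC 1)) (translate p g).
  have Hq : pvars_lt d q by do !split=> //; apply: pvars_lt_translate.
  have [l' [Hl' product_eq']] := orbit_along_fmonic q Hq.
  exists l'; split=> //; apply: filter_forall => t; rewrite product_eq'.
  apply: root_product_root; apply/in_map_iff; exists (fun s => peval (cbar s) q).
  split; last exact: orbit_along_self.
  rewrite /= peval_translate; set u := peval _ p; set v := peval _ p.
  change (u + RtoC (-1) * (RtoC 1 * v) = u - v)%C; ring.
Qed.

End Orbit.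

Theorem theorem7p1 (gT : finGroupType) (d n : nat)
  (rho : gT -> nat -> nat -> Cplx) (sigma : nat -> cpoly) (M : nat -> R)
  (c cbar : R -> nat -> Cplx) :
  linear_action d rho ->
  hilbert_basis d rho n sigma ->
  DC_weight M -> quasianalytic M ->
  forall eps : R, (0 < eps)%R ->
  CM_vec M (sym_interval eps) n c ->
  Cinf_vec (sym_interval eps) d cbar ->
  (forall t : R, sym_interval eps t ->
     forall j : nat, (j < n)%N -> peval (cbar t) (sigma j) = c t j) ->
  exists delta : R, (0 < delta)%R /\ CM_vec M (sym_interval delta) d cbar.
Proof.
move=> rho_action sigma_basis HM M_quasianalytic eps eps_pos Hc Hcbar lift.
have diverges := quasianalytic_unbounded_sums M HM M_quasianalytic.
have c_germ j : (j < n)%N -> CM_germ M (fun t => c t j).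
  by move=> j_lt; have [re_CM im_CM] := Hc j j_lt; apply: (CM_germ_of_CM_on M eps).
have cbar_germ i : (i < d)%N -> smooth_germ (fun t => cbar t i).
  by move=> i_lt; have [re_Cinf im_Cinf] := Hcbar i i_lt; apply: (smooth_germ_of_Cinf_on eps).
have lift_germ : locally 0%R (fun t => forall j, (j < n)%N -> peval (cbar t) (sigma j) = c t j).
  move: (locally_Rabs_lt 0 eps); rewrite Rabs_R0 => /(_ eps_pos); apply: filter_imp => t t_lt.
  by apply: lift; apply/sym_interval_iff.
have cbar_CM i : (i < d)%N -> CM_germ M (fun t => cbar t i).
  exact: (CM_germ_polynomial_along gT d rho rho_action n sigma M c cbar _ _ _ _ _ _ (PX i)).
have [delta [delta_pos cbar_CM_delta]] := at_right_0_ex _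
  (filter_forall_In (at_right 0%R) (enum 'I_d) (fun i r => CM_within M r (fun t => cbar t i))
    (fun i _ => cbar_CM i (ltn_ord i))).
exists delta; split=> // i i_lt.
have cbar_i := cbar_CM_delta (Ordinal i_lt) ((In_mem _ _ _).2 (mem_enum _ _)).
by split; [apply: CM_within_CM_on_re|apply: CM_within_CM_on_im].
Qed.
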